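(* Consider the finite horizon discounted expected cost transmission scheduling problem with two receivers and linear power-rate curves, with functions $G_n$ as described in the context. For every $n\in\{1,2,\ldots,N\}$ and $\mathbf{s}\in\mathcal{S}^1\times\mathcal{S}^2$, define the nonempty set of global minimizers $$\mathcal{B}_n(\mathbf{s}):=\Bigl\{\hat{\mathbf{y}}\in[d^1,\infty)\times[d^2,\infty):G_n(\hat{\mathbf{y}},\mathbf{s})=\min_{\mathbf{y}\in[d^1,\infty)\times[d^2,\infty)}G_n(\mathbf{y},\mathbf{s})\Bigr\},$$ and $$b_n^1(\mathbf{s}):=\min\{y^1\in[d^1,\infty):(y^1,y^2)\in\mathcal{B}_n(\mathbf{s})\text{ for some }y^2\in[d^2,\infty)\},\qquad b_n^2(\mathbf{s}):=\min\{y^2\in[d^2,\infty):(b_n^1(\mathbf{s}),y^2)\in\mathcal{B}_n(\mathbf{s})\}.$$ Then the vector $\mathbf{b}_n(\mathbf{s})=(b_n^1(\mathbf{s}),b_n^2(\mathbf{s}))\in\mathcal{B}_n(\mathbf{s})$ is a global minimizer of $G_n(\cdot,\mathbf{s})$. Define also $$f_n^1(x^2,\mathbf{s}):=\inf\Bigl\{\operatorname*{argmin}_{y^1\in[d^1,\infty)}G_n(y^1,x^2,s^1,s^2)\Bigr\},\ x^2\in[d^2,\infty),\qquad f_n^2(x^1,\mathbf{s}):=\inf\Bigl\{\operatorname*{argmin}_{y^2\in[d^2,\infty)}G_n(x^1,y^2,s^1,s^2)\Bigr\},\ x^1\in[d^1,\infty)$$ (so that $f_n^1(b_n^2(\mathbf{s}),\mathbf{s})=b_n^1(\mathbf{s})$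 and $f_n^2(b_n^1(\mathbf{s}),\mathbf{s})=b_n^2(\mathbf{s})$). Partition $[0,\infty)^2$ into the following seven regions: $$\begin{aligned}\mathcal{R}_{I}(n,\mathbf{s})&:=\{\mathbf{x}\in[0,\infty)^2:\mathbf{x}\succeq(f_n^1(x^2,\mathbf{s}),f_n^2(x^1,\mathbf{s}))\text{ and }\mathbf{x}\ne\mathbf{b}_n(\mathbf{s})\},\\ \mathcal{R}_{II}(n,\mathbf{s})&:=\{\mathbf{x}\in[0,\infty)^2:\mathbf{x}\preceq\mathbf{b}_n(\mathbf{s})\text{ and }\mathbf{c}_{\mathbf{s}}^{T}[\mathbf{b}_n(\mathbf{s})-\mathbf{x}]\le P\},\\ \mathcal{R}_{III\text{-}A}(n,\mathbf{s})&:=\{\mathbf{x}\in[0,\infty)^2:x^2>b_n^2(\mathbf{s})\text{ and }f_n^1(x^2,\mathbf{s})-\tfrac{P}{c_{s^1}}\le x^1<f_n^1(x^2,\mathbf{s})\},\\ \mathcal{R}_{III\text{-}B}(n,\mathbf{s})&:=\{\mathbf{x}\in[0,\infty)^2:x^1>b_n^1(\mathbf{s})\text{ and }f_n^2(x^1,\mathbf{s})-\tfrac{P}{c_{s^2}}\le x^2<f_n^2(x^1,\mathbf{s})\},\\ \mathcal{R}_{IV\text{-}A}(n,\mathbf{s})&:=\{\mathbf{x}\in[0,\infty)^2:x^2>b_n^2(\mathbf{s})\text{ and }x^1<f_n^1(x^2,\mathbf{s})-\tfrac{P}{c_{s^1}}\},\\ \mathcal{R}_{IV\text{-}B}(n,\mathbf{s})&:=\{\mathbf{x}\in[0,\infty)^2:\mathbf{x}\preceq\mathbf{b}_n(\mathbf{s})\text{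 and }\mathbf{c}_{\mathbf{s}}^{T}[\mathbf{b}_n(\mathbf{s})-\mathbf{x}]>P\},\\ \mathcal{R}_{IV\text{-}C}(n,\mathbf{s})&:=\{\mathbf{x}\in[0,\infty)^2:x^1>b_n^1(\mathbf{s})\text{ and }x^2<f_n^2(x^1,\mathbf{s})-\tfrac{P}{c_{s^2}}\},\end{aligned}$$ and define $\mathcal{R}_{IV}(n,\mathbf{s}):=\mathcal{R}_{IV\text{-}A}(n,\mathbf{s})\cup\mathcal{R}_{IV\text{-}B}(n,\mathbf{s})\cup\mathcal{R}_{IV\text{-}C}(n,\mathbf{s})$. Then for all $\mathbf{x}\notin\mathcal{R}_{IV}(n,\mathbf{s})$, an optimal control action (vector of buffer levels after transmission) with $n$ slots remaining is $$\mathbf{y}_n^*(\mathbf{x},\mathbf{s}):=\begin{cases}\mathbf{x},&\text{if }\mathbf{x}\in\mathcal{R}_{I}(n,\mathbf{s}),\\ \mathbf{b}_n(\mathbf{s}),&\text{if }\mathbf{x}\in\mathcal{R}_{II}(n,\mathbf{s}),\\ (f_n^1(x^2,\mathbf{s}),x^2),&\text{if }\mathbf{x}\in\mathcal{R}_{III\text{-}A}(n,\mathbf{s}),\\ (x^1,f_n^2(x^1,\mathbf{s})),&\text{if }\mathbf{x}\in\mathcal{R}_{III\text{-}B}(n,\mathbf{s}).\end{cases}$$ For all $\mathbf{x}\in\mathcal{R}_{IV}(n,\mathbf{s})$, there exists an optimal control action with $n$ slots remaining, $\mathbf{y}_n^*(\mathbf{x},\mathbf{s})$, which satisfies $$\m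athbf{c}_{\mathbf{s}}^{T}[\mathbf{y}_n^*(\mathbf{x},\mathbf{s})-\mathbf{x}]=P.$$
   Context: Time is discrete and indexed backwards: $n=N,\ldots,1$ is the number of slots remaining in a horizon of length $N\in\mathbb{N}$. There are two receivers; receiver $m\in\{1,2\}$ has channel condition process $\{S_n^m\}$, a finite-state ergodic homogeneous Markov chain on $\mathcal{S}^m$; the two chains are independent of each other and of the scheduling decisions. $\mathbf{S}_n=(S_n^1,S_n^2)\in\mathcal{S}:=\mathcal{S}^1\times\mathcal{S}^2$. Transmitting $z^m$ packets (real) to receiver $m$ under condition $s^m$ consumes power $c_{s^m}z^m$ with $c_{s^m}>0$ (the cost may depend on $m$); $\mathbf{c}_{\mathbf{s}}:=(c_{s^1},c_{s^2})$ and $\mathbf{c}_{\mathbf{s}}^{T}$ is its transpose. $P>0$ is the total power available per slot; $\mathbf{d}=(d^1,d^2)$ with $d^m>0$ gives the packets removed from each receiver's buffer at the end of each slot; it is assumed that $\mathbf{c}_{\mathbf{s}}^{T}\mathbf{d}\le P$ for all $\mathbf{s}\in\mathcal{S}$. The holding cost is $h(\mathbf{x}):=h^1(x^1)+h^2(x^2)$, each $h^m:[0,\infty)\to[0,\infty)$ being convex, nondecreasing, with $h^m(0)=0$ and $\lim_{x\to\infty}h^m(x)=\infty$. The discount factor is $\alpha\in[0,1]$. Vector inequalities $\preceq,\succeq$ are componentwise; $\vee$ is the componentwise maximum. In slot $n$, with buffer levels $\mathbf{X}_n=\mathbf{x}\in[0,\infty)^2$ and channel conditions $\mathbf{S}_n=\mathbf{s}$,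 the scheduler chooses a transmission vector $\mathbf{Z}_n=\mathbf{z}\succeq\max\{\mathbf{0},\mathbf{d}-\mathbf{x}\}$ with $\mathbf{c}_{\mathbf{s}}^{T}\mathbf{z}\le P$; $\mathbf{X}_{n-1}=\mathbf{X}_n+\mathbf{Z}_n-\mathbf{d}$; the slot cost is $\mathbf{c}_{\mathbf{s}}^{T}\mathbf{z}+h(\mathbf{x}+\mathbf{z}-\mathbf{d})$, and the expected total cost, discounted by $\alpha^{N-n}$ in slot $n$, is to be minimized over all history-dependent (possibly randomized) policies. With $\mathbf{y}=\mathbf{x}+\mathbf{z}$ (buffer levels after transmission, before playout) and $\tilde{\mathcal{A}}^{\mathbf{d}}(\mathbf{x},\mathbf{s}):=\{\mathbf{y}\in[0,\infty)^2:\mathbf{y}\succeq\mathbf{d}\vee\mathbf{x},\ \mathbf{c}_{\mathbf{s}}^{T}[\mathbf{y}-\mathbf{x}]\le P\}$, the dynamic program is $V_0=0$ and, for $n=1,\ldots,N$, $$V_n(\mathbf{x},\mathbf{s})=-\mathbf{c}_{\mathbf{s}}^{T}\mathbf{x}+\min_{\mathbf{y}\in\tilde{\mathcal{A}}^{\mathbf{d}}(\mathbf{x},\mathbf{s})}G_n(\mathbf{y},\mathbf{s}),$$ $$G_n(\mathbf{y},\mathbf{s}):=\mathbf{c}_{\mathbf{s}}^{T}\mathbf{y}+h(\mathbf{y}-\mathbf{d})+\alpha\,\mathbb{E}[V_{n-1}(\mathbf{y}-\mathbf{d},\mathbf{S}_{n-1})\mid\mathbf{S}_n=\mathbf{s}],\quad\mathbf{y}\in[d^1,\infty)\times[d^2,\infty).$$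 An optimal control action in state $(\mathbf{x},\mathbf{s})$ is a $\mathbf{y}$ attaining the minimum. $G_n(y^1,y^2,s^1,s^2)$ means $G_n((y^1,y^2),(s^1,s^2))$. Since $f_n^1(\cdot,\mathbf{s})$ and $f_n^2(\cdot,\mathbf{s})$ are defined only on $[d^2,\infty)$ and $[d^1,\infty)$ respectively, membership in $\mathcal{R}_I$ is understood to require $\mathbf{x}\succeq\mathbf{d}$. *)

(* Defs.v *)
(* MathComp-Analysis. *)
From HB Require Import structures.
From mathcomp Require Import all_boot all_order all_algebra.
From mathcomp Require Import all_classical all_reals all_analysis.

Set Implicit Arguments.
Unset Strict Implicit.
Unset Printing Implicit Defensive.

Import Order.TTheory GRing.Theory Num.Theory.
Import numFieldNormedType.Exports.

Local Open Scope classical_set_scope.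
Local Open Scope ring_scope.

Section FiniteMarkovChains.
Context {R : realType} {T : finType}.
Implicit Type p : T -> T -> R.

Definition stochastic p : Prop :=
  (forall i j, 0 <= p i j) /\ (forall i, \sum_j p i j = 1).

Fixpoint transn p (k : nat) : T -> T -> R :=
  if k is k'.+1 then fun i j => \sum_l p i l * transn p k' l j
  else fun i j => (i == j)%:R.

Definition irreducible_chain p : Prop :=
  forall i j, exists k, 0 < transn p k i j.

(* The greatest common divisor of the return times of every state is 1. *)
Definition aperiodic_chain p : Prop :=
  forall i (g : nat),
    (forall k, (0 < k)%N -> 0 < transn p k i i -> (g %| k)%N) -> g = 1%N.

Definition ergodic_chain p : Prop := irreducible_chain p /\ aperiodic_chain p.

End FiniteMarkovChains.

Section Vectors.
Context {R : realType}.
Implicit Types x y : R * R.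

Definition dot x y : R := x.1 * y.1 + x.2 * y.2.
Definition vle x y : Prop := x.1 <= y.1 /\ x.2 <= y.2.
Definition vmax x y : R * R := (Num.max x.1 y.1, Num.max x.2 y.2).

Definition argmin {T : Type} (D : set T) (g : T -> R) : set T :=
  [set y | D y /\ forall z, D z -> g y <= g z].

End Vectors.

(* [hold] and the functions below are total on R or R * R; only their values on
   [0, +oo[, resp. on buffer levels in the nonnegative orthant, are relevant. *)
Record receiver (R : realType) := Receiver {
  chan : finType;
  trans : chan -> chan -> R;
  unit_cost : chan -> R;
  demand : R;
  hold : R -> R }.
Arguments trans {R} r _ _ : rename.
Arguments unit_cost {R} r _ : rename.

Record scheduling (R : realType) := Scheduling {
  rcv1 : receiver R;
  rcv2 : receiver R;
  power : R;
  discount : R }.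

Definition state (R : realType) (M : scheduling R) : Type :=
  (chan (rcv1 M) * chan (rcv2 M))%type.

Section Problem.
Context {R : realType} (M : scheduling R).
Implicit Types (x y : R * R) (s t : state M) (n : nat).

Definition dvec : R * R := (demand (rcv1 M), demand (rcv2 M)).

Definition cvec s : R * R :=
  (unit_cost (rcv1 M) s.1, unit_cost (rcv2 M) s.2).

Definition holding x : R := hold (rcv1 M) x.1 + hold (rcv2 M) x.2.

Record receiver_assumptions (r : receiver R) : Prop := {
  ra_stochastic : stochastic (trans r);
  ra_ergodic : ergodic_chain (trans r);
  ra_cost_gt0 : forall a : chan r, 0 < unit_cost r a;
  ra_demand_gt0 : 0 < demand r;
  ra_hold_ge0 : forall u : R, 0 <= u -> 0 <= hold r u;
  ra_hold_convex : convex_function (`[0, +oo[%classic : set R) (hold r);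
  ra_hold_nondecreasing :
    forall u v : R, 0 <= u -> u <= v -> hold r u <= hold r v;
  ra_hold0 : hold r 0 = 0;
  ra_hold_infty : hold r u @[u --> +oo] --> +oo }.

Record standing_assumptions : Prop := {
  sa_rcv1 : receiver_assumptions (rcv1 M);
  sa_rcv2 : receiver_assumptions (rcv2 M);
  sa_power_gt0 : 0 < power M;
  sa_discount : 0 <= discount M <= 1;
  sa_demand_feasible : forall s, dot (cvec s) dvec <= power M }.

(* E[g(S_(n-1)) | S_n = s]: the two chains are independent, so the joint
   transition probabilities are products. *)
Definition cond_expect (g : state M -> R) s : R :=
  \sum_(t1 : chan (rcv1 M)) \sum_(t2 : chan (rcv2 M))
     trans (rcv1 M) s.1 t1 * trans (rcv2 M) s.2 t2 * g (t1, t2).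

Definition feasible x s : set (R * R) :=
  [set y | [/\ vle 0 y, vle (vmax dvec x) y
             & dot (cvec s) (y - x) <= power M]].

(* Objective of a slot, when [v] is the value function of the next slot. *)
Definition objective (v : R * R -> state M -> R) y s : R :=
  dot (cvec s) y + holding (y - dvec)
  + discount M * cond_expect (v (y - dvec)) s.

(* The minimum over the feasible set is rendered by [inf]; the two agree as
   soon as an optimal action exists. *)
Fixpoint V n x s : R :=
  if n is n'.+1 then
    - dot (cvec s) x + inf [set objective (V n') y s | y in feasible x s]
  else 0.

(* Only meaningful for n >= 1. *)
Definition G n y s : R := objective (V n.-1) y s.

Definition optimal_action n x s : set (R * R) :=
  argmin (feasible x s) (fun y => G n y s).

Definition B n s : set (R * R) :=
  argmin [set y | vle dvec y] (fun y => G n y s).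

(* b1 and b2 are minima, rendered by [inf]: as the sets are bounded below by the
   demands, the two agree as soon as (b1, b2) belongs to B. *)
Definition b1 n s : R := inf [set y1 : R | exists y2 : R, B n s (y1, y2)].
Definition b2 n s : R := inf [set y2 : R | B n s (b1 n s, y2)].
Definition b n s : R * R := (b1 n s, b2 n s).

Definition argmin1 n (x2 : R) s : set R :=
  argmin `[demand (rcv1 M), +oo[%classic (fun y1 : R => G n (y1, x2) s).
Definition argmin2 n (x1 : R) s : set R :=
  argmin `[demand (rcv2 M), +oo[%classic (fun y2 : R => G n (x1, y2) s).

Definition f1 n (x2 : R) s : R := inf (argmin1 n x2 s).
Definition f2 n (x1 : R) s : R := inf (argmin2 n x1 s).

Definition RI n s : set (R * R) :=
  [set x | [/\ vle 0 x, vle dvec x, vle (f1 n x.2 s, f2 n x.1 s) x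
             & x <> b n s]].

Definition RII n s : set (R * R) :=
  [set x | [/\ vle 0 x, vle x (b n s)
             & dot (cvec s) (b n s - x) <= power M]].

Definition RIIIA n s : set (R * R) :=
  [set x | [/\ vle 0 x, b2 n s < x.2
             & f1 n x.2 s - power M / (cvec s).1 <= x.1 < f1 n x.2 s]].

Definition RIIIB n s : set (R * R) :=
  [set x | [/\ vle 0 x, b1 n s < x.1
             & f2 n x.1 s - power M / (cvec s).2 <= x.2 < f2 n x.1 s]].

Definition RIVA n s : set (R * R) :=
  [set x | [/\ vle 0 x, b2 n s < x.2
             & x.1 < f1 n x.2 s - power M / (cvec s).1]].

Definition RIVB n s : set (R * R) :=
  [set x | [/\ vle 0 x, vle x (b n s)
             & power M < dot (cvec s) (b n s - x)]].

Definition RIVC n s : set (R * R) :=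
  [set x | [/\ vle 0 x, b1 n s < x.1
             & x.2 < f2 n x.1 s - power M / (cvec s).2]].

Definition RIV n s : set (R * R) := RIVA n s `|` RIVB n s `|` RIVC n s.

(* The last branch is only meant for x in [RIIIB n s]. *)
Definition ystar n x s : R * R :=
  if `[< RI n s x >] then x
  else if `[< RII n s x >] then b n s
  else if `[< RIIIA n s x >] then (f1 n x.2 s, x.2)
  else (x.1, f2 n x.1 s).

End Problem.

Inductive region_name := I | II | III_A | III_B | IV_A | IV_B | IV_C.

Definition region (R : realType) (M : scheduling R) (n : nat) (s : state M)
    (k : region_name) : set (R * R) :=
  match k with
  | I => RI n s
  | II => RII n s
  | III_A => RIIIA n s
  | III_B => RIIIB n s
  | IV_A => RIVA n s
  | IV_B => RIVB n s
  | IV_C => RIVC n s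
  end.

(* Main.v *)
Require Import Defs.
From mathcomp Require Import all_boot all_order all_algebra.
From mathcomp Require Import all_classical all_reals all_analysis.
From mathcomp Require Import ring lra.

(* By induction on the number of remaining slots, [V n] and [G n] are, as
   functions of the buffer levels, jointly convex, supermodular and Lipschitz on
   bounded sets; as [V n >= 0], [G n y s] dominates the cost of [y] and is thus
   coercive.  The delicate point is that minimization under a joint budget
   preserves supermodularity: optimal actions at the meet and at the join of two
   buffer vectors are exchanged for admissible actions at the two vectors without
   increasing the total cost.  Supermodularity then makes [f1] and [f2]
   nonincreasing, and the form of the optimal actions follows from convexity
   along a chord, issued from [b] or ending at the point that would be reached
   with unlimited power. *)

Import Order.TTheory GRing.Theory Num.Theory.
Import numFieldNormedType.Exports.

Local Open Scope classical_set_scope.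
Local Open Scope ring_scope.

(** * Attained minima *)

Section Argmin.
Context {R : realType}.

(** The argmin is the part of [A] inside the closed sublevel set at the minimum. Its compactness
    allows a second function to be minimized over it, hence lexicographic minimization. *)
Lemma compact_argmin {T : topologicalType} {A : set T} {f : T -> R} :
  compact A -> A !=set0 -> continuous f ->
  argmin A f !=set0 /\ compact (argmin A f).
Proof.
move=> cA A0 cf.
have [c cA' cmin] := compact_EVT_min A0 cA (continuous_subspaceT cf).
rewrite inE in cA'.
have cmin' z : A z -> f c <= f z by move=> Az; apply: cmin; rewrite inE.
split; first by exists c; split.
have -> : argmin A f = A `&` f @^-1` [set y | y <= f c].
  apply/seteqP; split=> [z [Az zmin]|z [Az /= zc]]; first by split=> //=; exact: zmin.
  by split=> // w Aw; apply: le_trans zc _; exact: cmin'.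
apply: compact_closedI => //; apply: preimage_closed; last exact: closed_le.
by move=> x _; apply: cf.
Qed.

Lemma inf_minimum (A : set R) (m : R) :
  A m -> (forall x, A x -> m <= x) -> inf A = m.
Proof.
move=> Am mA; apply/eqP; rewrite eq_le; apply/andP; split.
  by apply: ge_inf => //; exists m => x; exact: mA.
by apply: lb_le_inf; [exists m | move=> x; exact: mA].
Qed.

End Argmin.

(** * Regular functions *)

Section Regularity.
Context {R : realType}.
Implicit Types (a b : R) (g : R -> R -> R).

Definition convex2 a b g : Prop :=
  forall x1 x2 y1 y2 t, a <= x1 -> b <= x2 -> a <= y1 -> b <= y2 ->
    0 <= t -> t <= 1 ->
    g (x1 + t * (y1 - x1)) (x2 + t * (y2 - x2)) <=
    g x1 x2 + t * (g y1 y2 - g x1 x2).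

(** Here [x] and [y] are the meet and the join of [(x1, y2)] and [(y1, x2)]; equivalently,
    increments in one coordinate grow with the other. *)
Definition supermodular a b g : Prop :=
  forall x1 x2 y1 y2, a <= x1 -> b <= x2 -> x1 <= y1 -> x2 <= y2 ->
    g x1 y2 + g y1 x2 <= g x1 x2 + g y1 y2.

(** Quantitative continuity up to the boundary of the quadrant, where convexity alone does not give
    continuity. *)
Definition locally_lipschitz a b g : Prop :=
  forall K, exists2 L, 0 <= L & forall x1 x2 y1 y2,
    a <= x1 -> x1 <= K -> b <= x2 -> x2 <= K ->
    a <= y1 -> y1 <= K -> b <= y2 -> y2 <= K ->
    `|g x1 x2 - g y1 y2| <= L * (`|x1 - y1| + `|x2 - y2|).

Record regular a b g : Prop := {
  regular_convex : convex2 a b g;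
  regular_supermodular : supermodular a b g;
  regular_lipschitz : locally_lipschitz a b g }.

(** Composing with this projection onto [[a, K]] makes a locally Lipschitz function continuous on
    the whole plane, as [compact_argmin] asks, and leaves it unchanged on the box. *)
Definition clamp a K x := Num.max a (Num.min K x).

Lemma clamp_ge a K x : a <= clamp a K x.
Proof. by rewrite le_max lexx. Qed.

Lemma clamp_le a K x : a <= K -> clamp a K x <= K.
Proof. by move=> aK; rewrite ge_max aK ge_min lexx. Qed.

Lemma clamp_id a K x : a <= x -> x <= K -> clamp a K x = x.
Proof. by move=> ax xK; rewrite /clamp min_r // max_r. Qed.

Lemma clamp_lip a K x y : `|clamp a K x - clamp a K y| <= `|x - y|.
Proof.
wlog xy : x y / x <= y => [H|].
  by have [/H|/ltW /H] := leP x y; rewrite // (distrC y) (distrC (clamp a K y)).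
rewrite (distrC x) (ger0_norm (_ : 0 <= y - x)) ?subr_ge0 // ler_norml.
rewrite /clamp /Num.max /Num.min; case: (ltP K x) => ?; case: (ltP K y) => ?;
  do ?case: ltP => ?; lra.
Qed.

Lemma clamp_continuous {a b g} K : locally_lipschitz a b g -> a <= K -> b <= K ->
  continuous (fun p : R * R => g (clamp a K p.1) (clamp b K p.2)).
Proof.
move=> /(_ K) [L L0 gL] aK bK p.
apply/cvgrPdist_le => e e0; near=> q.
apply: le_trans (gL _ _ _ _ _ _ _ _ _ _ _ _) _; rewrite ?clamp_ge ?clamp_le //.
(* [L + 1] rather than [L], which may be 0. *)
have h1 : `|p.1 - q.1| <= e / 2 / (L + 1).
  near: q; have : (fst : R * R -> R) @ p --> p.1 by exact: cvg_fst.
  by move/cvgrPdist_le; apply; rewrite !divr_gt0 // ltr_wpDl.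
have h2 : `|p.2 - q.2| <= e / 2 / (L + 1).
  near: q; have : (snd : R * R -> R) @ p --> p.2 by exact: cvg_snd.
  by move/cvgrPdist_le; apply; rewrite !divr_gt0 // ltr_wpDl.
have L1 : 0 < L + 1 by rewrite ltr_wpDl.
rewrite ler_pdivlMr // in h1; rewrite ler_pdivlMr // in h2.
have k1 := clamp_lip a K p.1 q.1; have k2 := clamp_lip b K p.2 q.2.
have := ler_wpM2l L0 k1; have := ler_wpM2l L0 k2.
have := normr_ge0 (p.1 - q.1); have := normr_ge0 (p.2 - q.2).
nra.
Unshelve. all: by end_near.
Qed.

Lemma regular_argmin {a b g} K (A : set (R * R)) : locally_lipschitz a b g ->
  compact A -> A !=set0 ->
  (forall p, A p -> [/\ a <= p.1, p.1 <= K, b <= p.2 & p.2 <= K]) ->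
  argmin A (fun p => g p.1 p.2) !=set0 /\
  compact (argmin A (fun p => g p.1 p.2)).
Proof.
move=> gL cA A0 AK; case: (A0) => p /AK [p1 p2 p3 p4].
have := compact_argmin cA A0
  (clamp_continuous K gL (le_trans p1 p2) (le_trans p3 p4)).
suff -> : argmin A (fun p => g (clamp a K p.1) (clamp b K p.2)) =
  argmin A (fun p => g p.1 p.2) by [].
have E q : A q -> g (clamp a K q.1) (clamp b K q.2) = g q.1 q.2.
  by move=> /AK [q1 q2 q3 q4]; rewrite !clamp_id.
by apply/seteqP; split=> q [Aq qm]; split=> // r Ar; move: (qm _ Ar); rewrite !E.
Qed.

Lemma compact_box a b a' b' :
  compact [set p : R * R | [/\ a <= p.1, p.1 <= a', b <= p.2 & p.2 <= b']].
Proof.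
have := compact_setX (@segment_compact R a a') (@segment_compact R b b').
congr compact; apply/seteqP; split=> p /=; rewrite !in_itv /=.
  by case=> /andP[? ?] /andP[? ?]; split.
by case=> ? ? ? ?; split; apply/andP.
Qed.

End Regularity.

(** * Closure properties of regular functions *)

Section RegularityClosure.
Context {R : realType}.
Implicit Types (a b : R) (g : R -> R -> R).

Lemma regular_swap a b g : regular a b g -> regular b a (fun x y => g y x).
Proof.
move=> [cg sg lg]; split.
- by move=> x1 x2 y1 y2 t *; apply: cg.
- by move=> x1 x2 y1 y2 *; rewrite addrC; apply: sg.
- move=> K; have [L L0 gL] := lg K; exists L => // x1 x2 y1 y2 *.
  by rewrite [X in _ * X]addrC; apply: gL.
Qed.

Lemma regular0 a b : regular a b (fun _ _ => 0).
Proof.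
split; first by move=> *; lra.
  by move=> *; lra.
by move=> K; exists 0 => // *; rewrite subrr normr0 mul0r.
Qed.

Lemma regularD a b g g' : regular a b g -> regular a b g' ->
  regular a b (fun x y => g x y + g' x y).
Proof.
move=> [cg sg lg] [cg' sg' lg']; split.
- move=> x1 x2 y1 y2 t h1 h2 h3 h4 h5 h6.
  have := cg _ _ _ _ _ h1 h2 h3 h4 h5 h6; have := cg' _ _ _ _ _ h1 h2 h3 h4 h5 h6.
  lra.
- move=> x1 x2 y1 y2 h1 h2 h3 h4.
  have := sg _ _ _ _ h1 h2 h3 h4; have := sg' _ _ _ _ h1 h2 h3 h4; lra.
- move=> K; have [L L0 gL] := lg K; have [L' L'0 gL'] := lg' K.
  exists (L + L'); first exact: addr_ge0.
  move=> x1 x2 y1 y2 h1 h2 h3 h4 h5 h6 h7 h8.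
  rewrite opprD addrACA mulrDl; apply: le_trans (ler_normD _ _) _.
  by apply: lerD; [apply: gL | apply: gL'].
Qed.

Lemma regularZ a b k g : 0 <= k -> regular a b g ->
  regular a b (fun x y => k * g x y).
Proof.
move=> k0 [cg sg lg]; split.
- move=> x1 x2 y1 y2 t h1 h2 h3 h4 h5 h6.
  have := ler_wpM2l k0 (cg _ _ _ _ _ h1 h2 h3 h4 h5 h6); lra.
- move=> x1 x2 y1 y2 h1 h2 h3 h4.
  have := ler_wpM2l k0 (sg _ _ _ _ h1 h2 h3 h4); lra.
- move=> K; have [L L0 gL] := lg K; exists (k * L); first exact: mulr_ge0.
  move=> x1 x2 y1 y2 *.
  by rewrite -mulrBr normrM (ger0_norm k0) -mulrA ler_wpM2l // gL.
Qed.

Lemma regular_sum a b (I : Type) (r : seq I) (F : I -> R -> R -> R) :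
  (forall i, regular a b (F i)) -> regular a b (fun x y => \sum_(i <- r) F i x y).
Proof.
move=> rF; elim: r => [|i r IH].
  by under eq_fun do under eq_fun do rewrite big_nil; exact: regular0.
by under eq_fun do under eq_fun do rewrite big_cons; exact: regularD.
Qed.

Lemma regular_shift a b g :
  regular 0 0 g -> regular a b (fun x y => g (x - a) (y - b)).
Proof.
move=> [cg sg lg]; split.
- move=> x1 x2 y1 y2 t h1 h2 h3 h4 h5 h6.
  have -> : x1 + t * (y1 - x1) - a = x1 - a + t * (y1 - a - (x1 - a)) by ring.
  have -> : x2 + t * (y2 - x2) - b = x2 - b + t * (y2 - b - (x2 - b)) by ring.
  by apply: cg; rewrite ?subr_ge0.
- by move=> x1 x2 y1 y2 *; apply: sg; rewrite ?subr_ge0 ?lerD2r.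
(* This maximum bounds both shifted coordinates. *)
- move=> K; have [L L0 gL] := lg (Num.max (K - a) (K - b)); exists L => //.
  move=> x1 x2 y1 y2 *.
  have -> : x1 - y1 = x1 - a - (y1 - a) by ring.
  have -> : x2 - y2 = x2 - b - (y2 - b) by ring.
  by apply: gL; rewrite ?subr_ge0 ?le_max ?lerD2r //; apply/orP; (left + right).
Qed.

(** A separable function is supermodular with equality, which leaves only one-variable
    conditions. *)
Lemma regular_sep (k1 k2 : R -> R) a b :
  (forall x y t : R, a <= x -> a <= y -> 0 <= t -> t <= 1 ->
     k1 (x + t * (y - x)) <= k1 x + t * (k1 y - k1 x)) ->
  (forall x y t : R, b <= x -> b <= y -> 0 <= t -> t <= 1 ->
     k2 (x + t * (y - x)) <= k2 x + t * (k2 y - k2 x)) ->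
  (forall K, exists2 L, 0 <= L & forall x y, a <= x -> x <= K -> a <= y -> y <= K ->
     `|k1 x - k1 y| <= L * `|x - y|) ->
  (forall K, exists2 L, 0 <= L & forall x y, b <= x -> x <= K -> b <= y -> y <= K ->
     `|k2 x - k2 y| <= L * `|x - y|) ->
  regular a b (fun x y => k1 x + k2 y).
Proof.
move=> cv1 cv2 l1 l2; split.
- move=> x1 x2 y1 y2 t h1 h2 h3 h4 h5 h6.
  have := cv1 _ _ _ h1 h3 h5 h6; have := cv2 _ _ _ h2 h4 h5 h6; lra.
- by move=> x1 x2 y1 y2 *; lra.
- move=> K; have [L L0 gL] := l1 K; have [L' L'0 gL'] := l2 K.
  exists (L + L'); first exact: addr_ge0.
  move=> x1 x2 y1 y2 h1 h2 h3 h4 h5 h6 h7 h8.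
  have := gL _ _ h1 h2 h5 h6; have := gL' _ _ h3 h4 h7 h8.
  have := mulr_ge0 L0 (normr_ge0 (x2 - y2)).
  have := mulr_ge0 L'0 (normr_ge0 (x1 - y1)).
  have := ler_normD (k1 x1 - k1 y1) (k2 x2 - k2 y2).
  by rewrite opprD addrACA; lra.
Qed.

Lemma regular_linear (c1 c2 : R) a b : regular a b (fun x y => c1 * x + c2 * y).
Proof.
apply: regular_sep; try by move=> *; lra.
- by move=> K; exists `|c1| => // x y *; rewrite -mulrBr normrM.
- by move=> K; exists `|c2| => // x y *; rewrite -mulrBr normrM.
Qed.

Section Holding.
Variable h : R -> R.
Hypotheses (h0 : forall u : R, 0 <= u -> 0 <= h u)
  (hm : forall u v : R, 0 <= u -> u <= v -> h u <= h v)
  (hc : convex_function (`[0, +oo[%classic : set R) h).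

Lemma convex_function_chord (x y t : R) : 0 <= x -> 0 <= y -> 0 <= t -> t <= 1 ->
  h (x + t * (y - x)) <= h x + t * (h y - h x).
Proof.
move=> x0 y0 t0 t1; have := hc (Itv01 t0 t1) y x.
rewrite !inE /= !in_itv /= !andbT => /(_ y0 x0).
have -> : x + t * (y - x) = t * y + (1 - t) * x by ring.
have -> : h x + t * (h y - h x) = t * h y + (1 - t) * h x by ring.
exact.
Qed.

(* The slope of a chord issued from [u] is nondecreasing, hence bounded by the
   slope up to [K + 1]. *)
Lemma monotone_convex_lipschitz (K : R) :
  exists2 L, 0 <= L & forall x y : R, 0 <= x -> x <= K -> 0 <= y -> y <= K ->
     `|h x - h y| <= L * `|x - y|.
Proof.
have [K0|K0] := ltP K 0.
  by exists 0 => // x y x0 xK; have := le_trans x0 xK; rewrite leNgt K0.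
have hK : 0 <= h (K + 1) by apply: h0; lra.
exists (h (K + 1)) => // x y x0 xK y0 yK.
wlog xy : x y x0 xK y0 yK / x <= y => [H|].
  have [xy|/ltW xy] := leP x y; first exact: H.
  by rewrite distrC (distrC x); apply: H.
rewrite distrC (distrC x) !ger0_norm ?subr_ge0 ?hm //.
have q0 : 0 < K + 1 - x by lra.
have t0 : 0 <= (y - x) / (K + 1 - x) by apply: divr_ge0; lra.
have t1 : (y - x) / (K + 1 - x) <= 1 by rewrite ler_pdivrMr //; lra.
have t2 : (y - x) / (K + 1 - x) <= y - x.
  by rewrite ler_pdivrMr // ler_peMr ?subr_ge0 //; lra.
have K1 : 0 <= K + 1 by lra.
have := convex_function_chord x (K + 1) _ x0 K1 t0 t1.
rewrite divfK ?gt_eqF // addrC subrK.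
have := ler_wpM2r hK t2; have := mulr_ge0 t0 (h0 _ x0); lra.
Qed.

End Holding.

End RegularityClosure.

(** * Minimization under a power budget *)

Section Budget.
Context {R : realType}.
Implicit Types (g : R -> R -> R).

(** Coordinate form of [feasible]. With scalars instead of pairs, exchanging the receivers permutes
    arguments, so most statements are proved for one receiver and transferred by swapping. *)
Record budgeted (d1 d2 c1 c2 P x1 x2 y1 y2 : R) : Prop := Budgeted {
  budgeted_demand1 : d1 <= y1;
  budgeted_demand2 : d2 <= y2;
  budgeted_ge1 : x1 <= y1;
  budgeted_ge2 : x2 <= y2;
  budgeted_power : c1 * (y1 - x1) + c2 * (y2 - x2) <= P }.

Lemma budgeted_swap d1 d2 c1 c2 P x1 x2 y1 y2 :
  budgeted d1 d2 c1 c2 P x1 x2 y1 y2 -> budgeted d2 d1 c2 c1 P x2 x1 y2 y1.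
Proof. by case=> *; split=> //; rewrite addrC. Qed.

(** * Exchange of actions between meet and join *)

Section Exchange.
Context {d1 d2 c1 c2 P : R}.
Hypotheses (c1_gt0 : 0 < c1) (c2_gt0 : 0 < c2).

Lemma budgeted_le1 {x1 x2 y1 y2} : budgeted d1 d2 c1 c2 P x1 x2 y1 y2 ->
  y1 <= x1 + P / c1.
Proof.
case=> _ _ h1 h2 h3; rewrite -lerBlDl ler_pdivlMr // mulrC.
by apply: le_trans h3; rewrite lerDl mulr_ge0 ?subr_ge0 // ltW.
Qed.

Lemma budgeted_le2 {x1 x2 y1 y2} : budgeted d1 d2 c1 c2 P x1 x2 y1 y2 ->
  y2 <= x2 + P / c2.
Proof.
case=> _ _ h1 h2 h3; rewrite -lerBlDl ler_pdivlMr // mulrC.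
by apply: le_trans h3; rewrite lerDr mulr_ge0 ?subr_ge0 // ltW.
Qed.

(* [l] and [h] are the meet and the join of the buffer vectors [(h1, l2)] and
   [(l1, h2)]. If exchanging the first coordinates of [a] and [b] exceeds the
   budget, then [a] and [b] are so far apart that moving each of them by
   [h1 - l1] towards the other does not increase the cost. *)
Lemma exchange_shift {g l1 l2 h1 h2 a1 a2 b1 b2} : regular d1 d2 g ->
  l1 <= h1 -> l2 <= h2 ->
  budgeted d1 d2 c1 c2 P l1 l2 a1 a2 -> budgeted d1 d2 c1 c2 P h1 h2 b1 b2 ->
  a2 <= b2 -> P < c1 * (b1 - h1) + c2 * (a2 - l2) ->
  exists u1 u2 v1 v2, [/\ budgeted d1 d2 c1 c2 P h1 l2 u1 u2,
    budgeted d1 d2 c1 c2 P l1 h2 v1 v2 & g u1 u2 + g v1 v2 <= g a1 a2 + g b1 b2].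
Proof.
move=> [cg sg _] lh1 lh2 [A1 A2 A3 A4 A5] [B1 B2 B3 B4 B5] ab2 hP.
(* The pair [(b1, a2)] exceeds the budget at [(h1, l2)], while [a] fits it at [(l1, l2)]. *)
have gap : a1 - l1 < b1 - h1 by rewrite -(ltr_pM2l c1_gt0); lra.
exists (a1 + (h1 - l1)), a2, (b1 - (h1 - l1)), b2; split.
- by split; lra.
- by split; lra.
have ab1 : 0 < b1 - a1 by lra.
pose t := (h1 - l1) / (b1 - a1).
have t0 : 0 <= t by apply: divr_ge0; lra.
have t1 : t <= 1 by rewrite ler_pdivrMr //; lra.
(* Convexity in the row of [b2] moves [a1] and [b1] towards each other; supermodularity then carries
   the increment at [a1] down to the row of [a2]. *)
have tE : t * (b1 - a1) = h1 - l1 by rewrite divfK // gt_eqF.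
have s1 := cg _ _ _ _ t A1 B2 B1 B2 t0 t1.
have s2 := cg _ _ _ _ t B1 B2 A1 B2 t0 t1.
rewrite subrr mulr0 addr0 tE in s1.
rewrite subrr mulr0 addr0 -[a1 - b1]opprB mulrN tE in s2.
have := sg a1 a2 (a1 + (h1 - l1)) b2 A1 A2.
by rewrite lerDl subr_ge0 => /(_ lh1 ab2); lra.
Qed.

(* The two actions are taken symmetrically on the chord from [a] to [b]: [t] is the
   least parameter for which [u1] reaches [h1] and [v] fits its budget. *)
Lemma exchange_chord {g l1 l2 h1 h2 a1 a2 b1 b2} : regular d1 d2 g ->
  l1 <= h1 -> l2 <= h2 ->
  budgeted d1 d2 c1 c2 P l1 l2 a1 a2 -> budgeted d1 d2 c1 c2 P h1 h2 b1 b2 ->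
  a1 <= b1 -> b2 <= a2 ->
  exists u1 u2 v1 v2, [/\ budgeted d1 d2 c1 c2 P h1 l2 u1 u2,
    budgeted d1 d2 c1 c2 P l1 h2 v1 v2 & g u1 u2 + g v1 v2 <= g a1 a2 + g b1 b2].
Proof.
move=> [cg _ _] lh1 lh2 [A1 A2 A3 A4 A5] [B1 B2 B3 B4 B5] ab1 ba2.
have C1 : c1 * l1 <= c1 * h1 by rewrite ler_pM2l.
have C2 : c2 * l2 <= c2 * h2 by rewrite ler_pM2l.
pose D := c1 * (b1 - a1) + c2 * (b2 - a2).
suff [t [t0 t1 H1 H2 H3]] : exists t, [/\ 0 <= t, t <= 1, h1 <= a1 + t * (b1 - a1),
    c1 * (a1 - h1) + c2 * (a2 - l2) + t * D <= P &
    c1 * (b1 - l1) + c2 * (b2 - h2) - t * D <= P].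
  exists (a1 + t * (b1 - a1)), (a2 + t * (b2 - a2)).
  exists (b1 + t * (a1 - b1)), (b2 + t * (a2 - b2)).
  have T1 : 0 <= t * (b1 - a1) by rewrite mulr_ge0 ?subr_ge0.
  have T2 : 0 <= t * (a2 - b2) by rewrite mulr_ge0 ?subr_ge0.
  have T3 : t * (b1 - a1) <= b1 - a1 by rewrite ler_piMl ?subr_ge0.
  have T4 : t * (a2 - b2) <= a2 - b2 by rewrite ler_piMl ?subr_ge0.
  split; [split | split | ]; rewrite /D in H2 H3; try lra.
  have := cg _ _ _ _ t A1 A2 B1 B2 t0 t1; have := cg _ _ _ _ t B1 B2 A1 A2 t0 t1.
  lra.
(* At the least [s] with [u1 >= h1], either [s = 0], or [u1 = h1] and no power goes to the first
   receiver; in both cases [u] fits its budget. *)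
have [s [s0 s1 S1 S2]] : exists s, [/\ 0 <= s, s <= 1, h1 <= a1 + s * (b1 - a1) &
    c1 * (a1 - h1) + c2 * (a2 - l2) + s * D <= P].
  have [ha|ah] := leP h1 a1; first by exists 0; split; lra.
  have ab : 0 < b1 - a1 by lra.
  pose s := (h1 - a1) / (b1 - a1).
  have sE : s * (b1 - a1) = h1 - a1 by rewrite divfK // gt_eqF.
  have s0 : 0 <= s by apply: divr_ge0; lra.
  exists s; split=> //; first by rewrite ler_pdivrMr //; lra.
    by rewrite sE; lra.
  have -> : s * D = c1 * (s * (b1 - a1)) - c2 * (s * (a2 - b2)) by rewrite /D; ring.
  rewrite sE.
  have := mulr_ge0 (ltW c2_gt0) (mulr_ge0 s0 (_ : 0 <= a2 - b2)).
  rewrite subr_ge0 => /(_ ba2).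
  have := mulr_ge0 (ltW c1_gt0) (_ : 0 <= a1 - l1).
  rewrite subr_ge0 => /(_ A3); lra.
(* If [v] is still too expensive at [s], the parameter is increased until [v] costs exactly [P]. The
   costs of [u] and [v] add up to those of [a] and [b], at most [2P], so [u] still fits. *)
have [S3|S3] := leP (c1 * (b1 - l1) + c2 * (b2 - h2) - s * D) P; first by exists s.
have sD : 0 < (1 - s) * D by rewrite mulrBl mul1r /D in S3 *; lra.
have s1' : 0 < 1 - s.
  rewrite lt_neqAle subr_ge0 s1 andbT eq_sym.
  by apply: contraTneq sD => ->; rewrite mul0r ltxx.
have D0 : 0 < D by rewrite -(pmulr_rgt0 _ s1').
exists ((c1 * (b1 - l1) + c2 * (b2 - h2) - P) / D).
have st : s <= (c1 * (b1 - l1) + c2 * (b2 - h2) - P) / D by rewrite ler_pdivlMr //; lra.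
rewrite divfK ?gt_eqF //; split.
- exact: le_trans st.
- by rewrite ler_pdivrMr // /D; lra.
- by apply: le_trans S1 _; rewrite lerD2l ler_wpM2r ?subr_ge0.
- lra.
- lra.
Qed.

End Exchange.

(** By cases on the relative position of [a] and [b]; this is the supermodularity of the budgeted
    minimum, stated on actions. *)
Lemma exchange {d1 d2 c1 c2 P : R} {g l1 l2 h1 h2 a1 a2 b1 b2} :
  0 < c1 -> 0 < c2 -> regular d1 d2 g -> l1 <= h1 -> l2 <= h2 ->
  budgeted d1 d2 c1 c2 P l1 l2 a1 a2 -> budgeted d1 d2 c1 c2 P h1 h2 b1 b2 ->
  exists u1 u2 v1 v2, [/\ budgeted d1 d2 c1 c2 P h1 l2 u1 u2,
    budgeted d1 d2 c1 c2 P l1 h2 v1 v2 & g u1 u2 + g v1 v2 <= g a1 a2 + g b1 b2].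
Proof.
move=> c1_gt0 c2_gt0 rg lh1 lh2 Ha Hb.
have swap : (exists u1 u2 v1 v2, [/\ budgeted d2 d1 c2 c1 P h2 l1 u1 u2,
    budgeted d2 d1 c2 c1 P l2 h1 v1 v2 & g u2 u1 + g v2 v1 <= g a1 a2 + g b1 b2]) ->
  exists u1 u2 v1 v2, [/\ budgeted d1 d2 c1 c2 P h1 l2 u1 u2,
    budgeted d1 d2 c1 c2 P l1 h2 v1 v2 & g u1 u2 + g v1 v2 <= g a1 a2 + g b1 b2].
  move=> [u1 [u2 [v1 [v2 [Hu Hv Huv]]]]]; exists v2, v1, u2, u1.
  by split; [exact: budgeted_swap | exact: budgeted_swap | rewrite addrC].
have Ha' := budgeted_swap _ _ _ _ _ _ _ _ _ Ha.
have Hb' := budgeted_swap _ _ _ _ _ _ _ _ _ Hb.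
have rg' := regular_swap _ _ _ rg.
have [ab1|ba1] := leP a1 b1; have [ab2|ba2] := leP a2 b2; last first.
(* If [b] lies below [a] in both coordinates, [a] and [b] themselves are admissible at the two other
   vectors. *)
- exists a1, a2, b1, b2.
  have C1 : c1 * l1 <= c1 * h1 by rewrite ler_pM2l.
  have C2 : c2 * l2 <= c2 * h2 by rewrite ler_pM2l.
  have D1 : c1 * b1 <= c1 * a1 by rewrite ler_pM2l // ltW.
  have D2 : c2 * b2 <= c2 * a2 by rewrite ler_pM2l // ltW.
  by case: Ha => *; case: Hb => *; split=> //; split; lra.
- exact/swap/(exchange_chord c2_gt0 c1_gt0 rg' lh2 lh1 Ha' Hb' ab2 (ltW ba1)).
- exact: (exchange_chord c1_gt0 c2_gt0 rg lh1 lh2 Ha Hb ab1 (ltW ba2)).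
(* Now [a] lies below [b]. If both crossed pairs [(b1, a2)] and [(a1, b2)] fit their budgets,
   supermodularity of [g] concludes; otherwise a shift is used. *)
have [k1|k1] := ltP P (c1 * (b1 - h1) + c2 * (a2 - l2)).
  exact: (exchange_shift c1_gt0 rg lh1 lh2 Ha Hb ab2 k1).
have [k2|k2] := ltP P (c2 * (b2 - h2) + c1 * (a1 - l1)).
  exact/swap/(exchange_shift c2_gt0 rg' lh2 lh1 Ha' Hb' ab1 k2).
exists b1, a2, a1, b2; case: Ha => *; case: Hb => *; split; [split | split |] => //.
  by rewrite addrC.
by rewrite addrC; apply: (regular_supermodular _ _ _ rg).
Qed.

(** * The minimum as a function of the buffer levels *)

Section Value.
Context {d1 d2 c1 c2 P : R} {g : R -> R -> R}.
Hypotheses (c1_gt0 : 0 < c1) (c2_gt0 : 0 < c2) (rg : regular d1 d2 g)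
  (d1_ge0 : 0 <= d1) (d2_ge0 : 0 <= d2) (dP : c1 * d1 + c2 * d2 <= P).

Let budget (x1 x2 : R) := [set y : R * R | budgeted d1 d2 c1 c2 P x1 x2 y.1 y.2].

Lemma budgeted_compact (x1 x2 : R) : compact (budget x1 x2).
Proof.
have -> : budget x1 x2 =
  [set p : R * R | [/\ Num.max d1 x1 <= p.1, p.1 <= x1 + P / c1,
     Num.max d2 x2 <= p.2 & p.2 <= x2 + P / c2]] `&`
  (fun p : R * R => c1 * (p.1 - x1) + c2 * (p.2 - x2)) @^-1` [set y | y <= P].
  apply/seteqP; split=> p.
    move=> Hp; have ? := budgeted_le1 c1_gt0 c2_gt0 Hp.
    have ? := budgeted_le2 c1_gt0 c2_gt0 Hp.
    by case: Hp => *; split=> //; split; rewrite ?ge_max //; apply/andP.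
  by case; rewrite /= !ge_max => -[/andP[? ?] ? /andP[? ?] ?] ?; split.
apply: compact_closedI; first exact: compact_box.
apply: preimage_closed; last exact: closed_le.
move=> p _; apply: cvgD; (apply: cvgM; first exact: cvg_cst); apply: cvgB;
  try exact: cvg_cst; [exact: cvg_fst | exact: cvg_snd].
Qed.

(** The least action costs at most as much as the demands, so it is affordable from every buffer
    level. *)
Lemma demand_budgeted (x1 x2 : R) : 0 <= x1 -> 0 <= x2 ->
  budgeted d1 d2 c1 c2 P x1 x2 (Num.max d1 x1) (Num.max d2 x2).
Proof.
move=> x10 x20; split; rewrite ?le_max ?lexx ?orbT //.
apply: le_trans dP; apply: lerD; rewrite ler_pM2l // lerBlDr ge_max lerDl lerDr;
  exact/andP.
Qed.

Lemma budgeted_argmin (x1 x2 : R) : 0 <= x1 -> 0 <= x2 ->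
  exists y1 y2, budgeted d1 d2 c1 c2 P x1 x2 y1 y2 /\
    forall z1 z2, budgeted d1 d2 c1 c2 P x1 x2 z1 z2 -> g y1 y2 <= g z1 z2.
Proof.
move=> x10 x20.
have [] := @regular_argmin _ d1 d2 g (Num.max (x1 + P / c1) (x2 + P / c2))
  (budget x1 x2) (regular_lipschitz _ _ _ rg) (budgeted_compact x1 x2).
- by exists (Num.max d1 x1, Num.max d2 x2); exact: demand_budgeted.
- move=> y Hy; rewrite !le_max (budgeted_le1 c1_gt0 c2_gt0 Hy).
  by rewrite (budgeted_le2 c1_gt0 c2_gt0 Hy) orbT; case: Hy.
- move=> [[y1 y2] [Hy ymin]] _; exists y1, y2; split=> // z1 z2 Hz.
  exact: (ymin (z1, z2)).
Qed.

Definition budget_value (x1 x2 : R) := inf [set g y.1 y.2 | y in budget x1 x2].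

Lemma budget_value_attained (x1 x2 : R) : 0 <= x1 -> 0 <= x2 ->
  exists y1 y2, budgeted d1 d2 c1 c2 P x1 x2 y1 y2 /\ budget_value x1 x2 = g y1 y2.
Proof.
move=> x10 x20; have [y1 [y2 [Hy ymin]]] := budgeted_argmin _ _ x10 x20.
exists y1, y2; split=> //; apply: inf_minimum; first by exists (y1, y2).
by move=> _ [[z1 z2] Hz <-]; exact: ymin.
Qed.

Lemma budget_value_le (x1 x2 y1 y2 : R) : 0 <= x1 -> 0 <= x2 ->
  budgeted d1 d2 c1 c2 P x1 x2 y1 y2 -> budget_value x1 x2 <= g y1 y2.
Proof.
move=> x10 x20 Hy; have [z1 [z2 [Hz zmin]]] := budgeted_argmin _ _ x10 x20.
apply: ge_inf; last by exists (y1, y2).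
by exists (g z1 z2) => _ [[u1 u2] Hu <-]; exact: zmin.
Qed.

(** The budget constraints are jointly convex in buffers and actions, so a mixture of optimal
    actions is admissible at the mixture of the buffers. *)
Lemma budget_value_convex : convex2 0 0 budget_value.
Proof.
move=> x1 x2 y1 y2 t x10 x20 y10 y20 t0 t1.
have [u1 [u2 [[U1 U2 U3 U4 U5] ->]]] := budget_value_attained _ _ x10 x20.
have [v1 [v2 [[V1 V2 V3 V4 V5] ->]]] := budget_value_attained _ _ y10 y20.
apply: le_trans (regular_convex _ _ _ rg _ _ _ _ _ U1 U2 V1 V2 t0 t1).
have s0 : 0 <= 1 - t by rewrite subr_ge0.
have mix (p q p' q' : R) : p <= q -> p' <= q' -> p + t * (p' - p) <= q + t * (q' - q).
  by move=> pq pq'; have := ler_wpM2l t0 pq'; have := ler_wpM2l s0 pq; lra.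
have mix0 (p q q' : R) : p <= q -> p <= q' -> p <= q + t * (q' - q).
  by move=> pq pq'; have := mix _ _ _ _ pq pq'; rewrite subrr mulr0 addr0.
apply: budget_value_le; try exact: mix0.
split; [exact: mix0 | exact: mix0 | exact: mix | exact: mix |].
by have := mix _ _ _ _ U5 V5; rewrite subrr mulr0 addr0; lra.
Qed.

Lemma budget_value_supermodular : supermodular 0 0 budget_value.
Proof.
move=> x1 x2 y1 y2 x10 x20 xy1 xy2.
have y10 := le_trans x10 xy1; have y20 := le_trans x20 xy2.
have [a1 [a2 [Ha ->]]] := budget_value_attained _ _ x10 x20.
have [b1 [b2 [Hb ->]]] := budget_value_attained _ _ y10 y20.
have [u1 [u2 [v1 [v2 [Hu Hv Huv]]]]] := exchange c1_gt0 c2_gt0 rg xy1 xy2 Ha Hb.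
by apply: le_trans Huv; rewrite addrC; apply: lerD; apply: budget_value_le.
Qed.

(** An optimal action [v] at [y] is turned into an admissible action [u] at [x] whose distance to
    [v] is linear in that from [x] to [y]; the Lipschitz bound of [g] then applies. *)
Lemma budget_value_lipschitz : locally_lipschitz 0 0 budget_value.
Proof.
(* No action affordable from buffers below [K] exceeds [K']. *)
move=> K; pose K' := Num.max (K + P / c1) (K + P / c2).
have [L L0 gL] := regular_lipschitz _ _ _ rg K'.
(* The 1 accounts for the change of the least action, the quotients for the power [E] given up,
   converted into packets of each receiver. *)
pose C := 1 + (c1 + c2) / c1 + (c1 + c2) / c2.
have Q1 : 0 <= (c1 + c2) / c1 by rewrite divr_ge0 ?addr_ge0 // ltW.
have Q2 : 0 <= (c1 + c2) / c2 by rewrite divr_ge0 ?addr_ge0 // ltW.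
exists (L * C); first by rewrite mulr_ge0 // /C; lra.
suff H (x1 x2 y1 y2 : R) : 0 <= x1 -> x1 <= K -> 0 <= x2 -> x2 <= K ->
    0 <= y1 -> y1 <= K -> 0 <= y2 -> y2 <= K ->
    budget_value x1 x2 - budget_value y1 y2 <= L * C * (`|x1 - y1| + `|x2 - y2|).
  move=> x1 x2 y1 y2 *; rewrite ler_norml H // andbT lerNl opprB.
  by rewrite (distrC x1) (distrC x2) H.
move=> x10 x1K x20 x2K y10 y1K y20 y2K.
have inK (z1 z2 w1 w2 : R) : z1 <= K -> z2 <= K -> budgeted d1 d2 c1 c2 P z1 z2 w1 w2 ->
    w1 <= K' /\ w2 <= K'.
  move=> zK1 zK2 Hw; rewrite !le_max.
  have := budgeted_le1 c1_gt0 c2_gt0 Hw; have := budgeted_le2 c1_gt0 c2_gt0 Hw => e2 e1.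
  by split; apply/orP; [left | right]; [apply: le_trans e1 _ | apply: le_trans e2 _];
    rewrite lerD2r.
have [v1 [v2 [Hv ->]]] := budget_value_attained _ _ y10 y20.
set D1 := `|x1 - y1|; set D2 := `|x2 - y2|.
have [D10 D20] : 0 <= D1 /\ 0 <= D2 by rewrite !normr_ge0.
(* Both the least action and the amount it transmits vary by at most the change of the buffer. *)
have max_lip (d x y : R) : `|Num.max d x - Num.max d y| <= `|x - y| /\
    (Num.max d x - x) - (Num.max d y - y) <= `|x - y|.
  rewrite ler_norml /Num.max; case: (ltP d x) => ?; case: (ltP d y) => ?;
  by case: (ler0P (x - y)) => ?; split; lra.
have [M1 N1] := max_lip d1 x1 y1; have [M2 N2] := max_lip d2 x2 y2.
have Hx := demand_budgeted _ _ x10 x20.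
rewrite -/D1 -/D2 in M1 N1 M2 N2.
set m1 := Num.max d1 x1 in M1 N1 Hx; set m2 := Num.max d2 x2 in M2 N2 Hx.
set n1 := Num.max d1 y1 in M1 N1; set n2 := Num.max d2 y2 in M2 N2.
have W1 : 0 <= v1 - n1 by case: Hv => *; rewrite subr_ge0 ge_max; apply/andP.
have W2 : 0 <= v2 - n2 by case: Hv => *; rewrite subr_ge0 ge_max; apply/andP.
(* The excess of [v] over the minimal action at [y] is scaled down until it
   fits the power left by the minimal action at [x]. *)
pose s := c1 * (v1 - n1) + c2 * (v2 - n2).
pose E := c1 * D1 + c2 * D2.
have E0 : 0 <= E by rewrite addr_ge0 // mulr_ge0 // ltW.
have s0 : 0 <= s by rewrite addr_ge0 // mulr_ge0 // ltW.
(* [t] is the discarded fraction of the excess, 0 or just enough to meet the budget. The power it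
   frees is at most [E], as the least cost varies by at most [E] and [v] was affordable at [y]. *)
have [t [t0 t1 T1 T2]] : exists t, [/\ 0 <= t, t <= 1,
    c1 * (m1 - x1) + c2 * (m2 - x2) + (1 - t) * s <= P & t * s <= E].
  have Px : c1 * (m1 - x1) + c2 * (m2 - x2) <= P by case: Hx.
  have [k|k] := leP (c1 * (m1 - x1) + c2 * (m2 - x2) + s) P.
    by exists 0; split; lra.
  have s1 : 0 < s by lra.
  exists ((c1 * (m1 - x1) + c2 * (m2 - x2) + s - P) / s).
  have -> : (1 - (c1 * (m1 - x1) + c2 * (m2 - x2) + s - P) / s) * s =
            P - (c1 * (m1 - x1) + c2 * (m2 - x2)) by field; rewrite gt_eqF.
  rewrite divfK ?gt_eqF //; split.
  - by apply: divr_ge0; lra.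
  - by rewrite ler_pdivrMr //; lra.
  - lra.
  have := ler_wpM2l (ltW c1_gt0) N1; have := ler_wpM2l (ltW c2_gt0) N2.
  by case: Hv => _ _ _ _; rewrite /E /s; lra.
have E1 : t * (v1 - n1) <= E / c1.
  rewrite ler_pdivlMr //; apply: le_trans T2.
  have := mulr_ge0 t0 (mulr_ge0 (ltW c2_gt0) W2); rewrite /s; lra.
have E2 : t * (v2 - n2) <= E / c2.
  rewrite ler_pdivlMr //; apply: le_trans T2.
  have := mulr_ge0 t0 (mulr_ge0 (ltW c1_gt0) W1); rewrite /s; lra.
have e1 := mulr_ge0 t0 W1; have e2 := mulr_ge0 t0 W2.
have f1 : t * (v1 - n1) <= v1 - n1 by rewrite ler_piMl.
have f2 : t * (v2 - n2) <= v2 - n2 by rewrite ler_piMl.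
pose u1 := m1 + (v1 - n1) - t * (v1 - n1).
pose u2 := m2 + (v2 - n2) - t * (v2 - n2).
have Hu : budgeted d1 d2 c1 c2 P x1 x2 u1 u2.
  by case: Hx => *; split; rewrite /u1 /u2; rewrite /s in T1; lra.
have [u1K u2K] := inK _ _ _ _ x1K x2K Hu; have [v1K v2K] := inK _ _ _ _ y1K y2K Hv.
have := budget_value_le _ _ _ _ x10 x20 Hu.
have g1 : `|u1 - v1| <= D1 + E / c1.
  have -> : u1 - v1 = (m1 - n1) - t * (v1 - n1) by rewrite /u1; ring.
  by apply: le_trans (ler_normB _ _) _; rewrite (ger0_norm e1) lerD.
have g2 : `|u2 - v2| <= D2 + E / c2.
  have -> : u2 - v2 = (m2 - n2) - t * (v2 - n2) by rewrite /u2; ring.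
  by apply: le_trans (ler_normB _ _) _; rewrite (ger0_norm e2) lerD.
have EC : E <= (c1 + c2) * (D1 + D2).
  have := mulr_ge0 (ltW c1_gt0) D20; have := mulr_ge0 (ltW c2_gt0) D10.
  by rewrite /E; lra.
have : g u1 u2 - g v1 v2 <= L * (`|u1 - v1| + `|u2 - v2|).
  apply: le_trans (ler_norm _) _.
  by case: Hu => *; case: Hv => *; apply: gL.
have : L * (`|u1 - v1| + `|u2 - v2|) <= L * (C * (D1 + D2)).
  apply: ler_wpM2l => //; apply: le_trans (lerD g1 g2) _.
  have i1 : 0 <= c1^-1 by rewrite invr_ge0 ltW.
  have i2 : 0 <= c2^-1 by rewrite invr_ge0 ltW.
  have := ler_wpM2r i1 EC; have := ler_wpM2r i2 EC; rewrite /C; lra.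
rewrite mulrA; lra.
Qed.

Lemma budget_value_regular : regular 0 0 budget_value.
Proof.
split; [exact: budget_value_convex | exact: budget_value_supermodular |].
exact: budget_value_lipschitz.
Qed.

End Value.

End Budget.

(** * Minimizers and regions *)

Section Minimizers.
Context {R : realType}.
Implicit Types (d c P : R) (g : R -> R -> R).

Definition minimizer d1 d2 g (y1 y2 : R) : Prop :=
  [/\ d1 <= y1, d2 <= y2 &
      forall z1 z2, d1 <= z1 -> d2 <= z2 -> g y1 y2 <= g z1 z2].

(** The attained form of the infima that define [f1] and [f2]. *)
Definition least_argmin d (k : R -> R) (m : R) : Prop :=
  [/\ d <= m, forall z, d <= z -> k m <= k z &
      forall z, d <= z -> (forall w, d <= w -> k z <= k w) -> m <= z].

Lemma minimizer_swap d1 d2 g (y1 y2 : R) :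
  minimizer d1 d2 g y1 y2 -> minimizer d2 d1 (fun x y => g y x) y2 y1.
Proof. by case=> ? ? H; split=> // *; exact: H. Qed.

Lemma minimizer_le d1 d2 g (y1 y2 z1 z2 : R) : minimizer d1 d2 g y1 y2 ->
  d1 <= z1 -> d2 <= z2 -> g z1 z2 <= g y1 y2 -> minimizer d1 d2 g z1 z2.
Proof.
move=> [_ _ H] h1 h2 h; split=> // w1 w2 k1 k2; exact: le_trans h (H _ _ k1 k2).
Qed.

(** * Existence of least minimizers *)

Section Coercive.
Context {d1 d2 c1 c2 : R} {g : R -> R -> R}.
Hypotheses (d1_ge0 : 0 <= d1) (d2_ge0 : 0 <= d2) (c1_gt0 : 0 < c1)
  (c2_gt0 : 0 < c2) (rg : regular d1 d2 g)
  (coercive : forall y1 y2, d1 <= y1 -> d2 <= y2 -> c1 * y1 + c2 * y2 <= g y1 y2).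

Lemma coercive_bound (m y1 y2 : R) : d1 <= y1 -> d2 <= y2 -> g y1 y2 <= m ->
  y1 <= m / c1 /\ y2 <= m / c2.
Proof.
move=> h1 h2 hm; have := le_trans (coercive _ _ h1 h2) hm.
have k1 := mulr_ge0 (ltW c1_gt0) (le_trans d1_ge0 h1).
have k2 := mulr_ge0 (ltW c2_gt0) (le_trans d2_ge0 h2).
by move=> ?; rewrite !ler_pdivlMr // ![_ * c1]mulrC ![_ * c2]mulrC; split; lra.
Qed.

Lemma lex_least_minimizer : exists y1 y2, [/\ minimizer d1 d2 g y1 y2,
  forall z1 z2, minimizer d1 d2 g z1 z2 -> y1 <= z1 &
  forall z2, minimizer d1 d2 g y1 z2 -> y2 <= z2].
Proof.
(* By coercivity, every point at which [g] is at most its value at the demands lies in the box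
   [A]. *)
pose m := g d1 d2; pose K := Num.max (m / c1) (m / c2).
pose A := [set p : R * R | [/\ d1 <= p.1, p.1 <= K, d2 <= p.2 & p.2 <= K]].
have inA (y1 y2 : R) : d1 <= y1 -> d2 <= y2 -> g y1 y2 <= m -> A (y1, y2).
  move=> h1 h2 hm; have [k1 k2] := coercive_bound _ _ _ h1 h2 hm.
  by split; rewrite //= le_max ?k1 ?k2 ?orbT.
have [ne cpt] := regular_argmin K A (regular_lipschitz _ _ _ rg)
  (compact_box _ _ _ _) (ex_intro _ (d1, d2) (inA d1 d2 (lexx _) (lexx _) (lexx _)))
  (fun p Hp => Hp).
have argminP (y1 y2 : R) :
    argmin A (fun p => g p.1 p.2) (y1, y2) <-> minimizer d1 d2 g y1 y2.
  split=> [[[/= h1 _ h2 _] hmin]|[h1 h2 hmin]].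
    split=> // z1 z2 k1 k2; have [k|/ltW k] := leP (g z1 z2) m.
      exact: (hmin (z1, z2) (inA _ _ k1 k2 k)).
    by apply: le_trans k; exact: (hmin (d1, d2) (inA d1 d2 (lexx _) (lexx _) (lexx _))).
  by split=> [|[z1 z2] [/= k1 _ k2 _]]; [apply: inA => //|]; apply: hmin.
(* The first coordinate is minimized over the compact set of minimizers, then the second over what
   remains. *)
have [ne1 cpt1] := compact_argmin cpt ne (fun x : R * R => cvg_fst).
have [[[y1 y2] [[Hy y1min] y2min]] _] :=
  compact_argmin cpt1 ne1 (fun x : R * R => cvg_snd).
exists y1, y2; split; first exact/argminP.
  by move=> z1 z2 /argminP; exact: y1min.
move=> z2 /argminP Hz; apply: (y2min (y1, z2)); split=> //; exact: y1min.
Qed.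

Lemma least_argmin1 (x2 : R) : d2 <= x2 ->
  exists m, least_argmin d1 (fun y => g y x2) m.
Proof.
move=> dx2; pose m := g d1 x2.
pose K := Num.max (m / c1) (m / c2).
(* The row of [x2] is treated as a degenerate box. *)
pose A := [set p : R * R | [/\ d1 <= p.1, p.1 <= K, x2 <= p.2 & p.2 <= x2]].
have inA (y1 : R) : d1 <= y1 -> g y1 x2 <= m -> A (y1, x2).
  move=> h1 hm; have [k1 _] := coercive_bound _ _ _ h1 dx2 hm.
  by split; rewrite //= le_max k1.
have A1 := inA d1 (lexx _) (lexx _).
have AK p : A p -> [/\ d1 <= p.1, p.1 <= K, d2 <= p.2 & p.2 <= K].
  case=> ? ? h1 h2; split=> //; first exact: le_trans h1.
  apply: le_trans h2 _; rewrite le_max; apply/orP; right.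
  by case: (coercive_bound m d1 x2 (lexx _) dx2 (lexx _)).
have [ne cpt] := regular_argmin K A (regular_lipschitz _ _ _ rg)
  (compact_box _ _ _ _) (ex_intro _ (d1, x2) A1) AK.
have [[[y1 y2] [[[/= h1 h2 h3 h4] hmin] y1min]] _] :=
  compact_argmin cpt ne (fun x : R * R => cvg_fst).
have E : y2 = x2 by apply/eqP; rewrite eq_le h4 h3.
rewrite {}E {y2 h3 h4} in hmin y1min.
have gmin (z : R) : d1 <= z -> g y1 x2 <= g z x2.
  move=> dz; have [k|/ltW k] := leP (g z x2) m; first exact: (hmin (z, x2) (inA z dz k)).
  by apply: le_trans k; exact: (hmin (d1, x2) A1).
exists y1; split=> // z dz zmin; apply: (y1min (z, x2)); split.
  by apply: inA => //; apply: zmin.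
move=> [w1 w2] [/= k1 _ k2 k3].
have -> : w2 = x2 by apply/eqP; rewrite eq_le k3 k2.
exact: zmin.
Qed.

End Coercive.

(** * Behaviour along rows and columns *)

Section Regions.
Context {d1 d2 : R} {g : R -> R -> R} {F1 F2 : R -> R} {b1 b2 : R}.
Hypotheses (rg : regular d1 d2 g) (bmin : minimizer d1 d2 g b1 b2)
  (F1P : forall x2, d2 <= x2 -> least_argmin d1 (fun y => g y x2) (F1 x2))
  (F2P : forall x1, d1 <= x1 -> least_argmin d2 (g x1) (F2 x1))
  (F1b2 : F1 b2 = b1) (F2b1 : F2 b1 = b2).

(** If [F1 x2 < F1 y2], moving left from [F1 y2] to [F1 x2] does not increase [g] in row [x2], hence
    by supermodularity not in row [y2] either, against the leastness of [F1 y2]. *)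
Lemma least_argmin1_nonincreasing (x2 y2 : R) :
  d2 <= x2 -> x2 <= y2 -> F1 y2 <= F1 x2.
Proof.
move=> dx2 xy2; have [h1 h2 h3] := F1P _ dx2.
have [k1 k2 k3] := F1P _ (le_trans dx2 xy2).
rewrite leNgt; apply/negP => lt; move: (lt); apply/negP; rewrite -leNgt.
apply: k3 => // w dw; apply: le_trans (k2 _ dw).
have := regular_supermodular _ _ _ rg _ _ _ _ h1 dx2 (ltW lt) xy2.
have := h2 _ k1; lra.
Qed.

(** A convex function is nondecreasing to the right of a minimizer. *)
Lemma row_nondecreasing (x2 y z : R) :
  d2 <= x2 -> F1 x2 <= y -> y <= z -> g y x2 <= g z x2.
Proof.
move=> dx2 Fy yz; have [h1 h2 h3] := F1P _ dx2.
have [<-//|yz'] := eqVneq y z.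
have zF : 0 < z - F1 x2 by rewrite subr_gt0 (le_lt_trans Fy) // lt_neqAle yz' yz.
pose t := (y - F1 x2) / (z - F1 x2).
have t0 : 0 <= t by apply: divr_ge0; [rewrite subr_ge0 | exact: ltW].
have t1 : t <= 1 by rewrite ler_pdivrMr // mul1r lerD2r.
have dz : d1 <= z by rewrite (le_trans h1) // (le_trans Fy).
have := regular_convex _ _ _ rg _ _ _ _ t h1 dx2 dz dx2 t0 t1.
rewrite subrr mulr0 addr0 divfK ?gt_eqF // addrC subrK.
have := h2 _ dz; rewrite -subr_ge0 => H; have := ler_wpM2r H t1; lra.
Qed.

(** On a chord, convexity bounds [g] by the larger of the two end values. *)
Lemma chord_crosses_row (x2 y1 y2 z1 z2 : R) :
  d1 <= y1 -> d2 <= y2 -> d1 <= z1 -> y2 < x2 -> x2 <= z2 ->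
  g y1 y2 <= g z1 z2 ->
  exists t, [/\ 0 <= t, t <= 1 & g (y1 + t * (z1 - y1)) x2 <= g z1 z2].
Proof.
move=> h1 h2 h3 yx xz gyz; have yz : 0 < z2 - y2 by rewrite subr_gt0 (lt_le_trans yx).
have dz2 : d2 <= z2 by rewrite (le_trans h2) // -subr_ge0 ltW.
pose t := (x2 - y2) / (z2 - y2).
have t0 : 0 <= t by apply: divr_ge0; [rewrite subr_ge0 ltW | exact: ltW].
have t1 : t <= 1 by rewrite ler_pdivrMr // mul1r lerD2r.
exists t; split=> //.
have := regular_convex _ _ _ rg _ _ _ _ t h1 h2 h3 dz2 t0 t1.
rewrite divfK ?gt_eqF // [y2 + _]addrC subrK.
rewrite -subr_ge0 in gyz; have := ler_wpM2r gyz t1; lra.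
Qed.

(** The chord from [b] to any point on or above row [x2] meets that row at a value no larger than
    the one at its end. *)
Lemma row_argmin_optimal (x2 y1 y2 : R) :
  b2 < x2 -> d1 <= y1 -> x2 <= y2 -> g (F1 x2) x2 <= g y1 y2.
Proof.
move=> bx dy1 xy; have [B1 B2 B3] := bmin.
have dx2 : d2 <= x2 by rewrite (le_trans B2) // ltW.
have [t [t0 t1]] := chord_crosses_row _ _ _ _ _ B1 B2 dy1 bx xy
  (B3 _ _ dy1 (le_trans dx2 xy)).
apply: le_trans; have [_ + _] := F1P _ dx2; apply.
have := mulr_ge0 t0 (_ : 0 <= y1 - d1); rewrite subr_ge0 => /(_ dy1).
have := mulr_ge0 (_ : 0 <= 1 - t) (_ : 0 <= b1 - d1).
by rewrite !subr_ge0 => /(_ t1 B1); lra.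
Qed.

(* Otherwise the chord from [b] to the column minimizer [(x1, F2 x1)] would
   cross the row of [x2] to the right of [x1], with a value below [g x1 x2]. *)
Lemma column_argmin_le (x1 x2 : R) :
  b2 < x2 -> F1 x2 <= x1 -> x1 <= b1 -> F2 x1 <= x2.
Proof.
move=> bx Fx xb; have [//|lt] := leP (F2 x1) x2.
have [B1 B2 B3] := bmin.
have dx2 : d2 <= x2 by rewrite (le_trans B2) // ltW.
have dx1 : d1 <= x1 by have [h _ _] := F1P _ dx2; exact: le_trans h Fx.
have [k1 k2 k3] := F2P _ dx1.
have [t [t0 t1 H]] := chord_crosses_row _ _ _ _ _ B1 B2 dx1 bx (ltW lt) (B3 _ _ dx1 k1).
have : g x1 x2 <= g (b1 + t * (x1 - b1)) x2.
  apply: row_nondecreasing => //.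
  have := mulr_ge0 (_ : 0 <= 1 - t) (_ : 0 <= b1 - x1).
  by rewrite !subr_ge0 => /(_ t1 xb); lra.
move=> H'; have := k3 x2 dx2 (fun w dw => le_trans H' (le_trans H (k2 w dw))).
by rewrite leNgt lt.
Qed.

(** Moving right does not decrease [g] in row [x2], nor, by supermodularity, in the higher row [y2];
    moving up in column [x1] is covered by assumption. *)
Lemma stay_optimal (x1 x2 y1 y2 : R) : d1 <= x1 -> d2 <= x2 ->
  F1 x2 <= x1 -> g x1 x2 <= g x1 y2 -> x1 <= y1 -> x2 <= y2 -> g x1 x2 <= g y1 y2.
Proof.
move=> dx1 dx2 Fx1 gx xy1 xy2.
have := row_nondecreasing _ _ _ dx2 Fx1 xy1.
have := regular_supermodular _ _ _ rg _ _ _ _ dx1 dx2 xy1 xy2; lra.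
Qed.

End Regions.

(* The chord from any optimal action to [q] meets the budget line. *)
Lemma full_power_optimal d1 d2 c1 c2 P g (x1 x2 q1 q2 : R) :
  0 < c1 -> 0 < c2 -> regular d1 d2 g -> 0 <= d1 -> 0 <= d2 ->
  c1 * d1 + c2 * d2 <= P -> 0 <= x1 -> 0 <= x2 ->
  d1 <= q1 -> d2 <= q2 -> x1 <= q1 -> x2 <= q2 ->
  P < c1 * (q1 - x1) + c2 * (q2 - x2) ->
  (forall y1 y2, d1 <= y1 -> d2 <= y2 -> x1 <= y1 -> x2 <= y2 -> g q1 q2 <= g y1 y2) ->
  exists y1 y2, [/\ budgeted d1 d2 c1 c2 P x1 x2 y1 y2,
    forall z1 z2, budgeted d1 d2 c1 c2 P x1 x2 z1 z2 -> g y1 y2 <= g z1 z2 &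
    c1 * (y1 - x1) + c2 * (y2 - x2) = P].
Proof.
move=> c10 c20 rg d10 d20 dP x10 x20 dq1 dq2 xq1 xq2 hq qmin.
have [y1 [y2 [[h1 h2 h3 h4 h5] ymin]]] := budgeted_argmin c10 c20 rg d10 d20 dP _ _ x10 x20.
pose D := c1 * (q1 - y1) + c2 * (q2 - y2).
have D0 : 0 < D by rewrite /D; lra.
pose t := (P - (c1 * (y1 - x1) + c2 * (y2 - x2))) / D.
have t0 : 0 <= t by apply: divr_ge0; lra.
have t1 : t <= 1 by rewrite ler_pdivrMr // /D; lra.
have tD : t * D = P - (c1 * (y1 - x1) + c2 * (y2 - x2)) by rewrite divfK // gt_eqF.
have s0 : 0 <= 1 - t by lra.
have mix (p y q : R) : p <= y -> p <= q -> p <= y + t * (q - y).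
  move=> py pq; have := mulr_ge0 s0 (_ : 0 <= y - p); rewrite subr_ge0 => /(_ py).
  by have := mulr_ge0 t0 (_ : 0 <= q - p); rewrite subr_ge0 => /(_ pq); lra.
have E : c1 * (y1 + t * (q1 - y1) - x1) + c2 * (y2 + t * (q2 - y2) - x2) = P.
  by transitivity (c1 * (y1 - x1) + c2 * (y2 - x2) + t * D); [rewrite /D; ring | lra].
exists (y1 + t * (q1 - y1)), (y2 + t * (q2 - y2)); split=> //.
  by split; try exact: mix; rewrite E.
move=> z1 z2 Hz; apply: le_trans (ymin _ _ Hz).
apply: le_trans (regular_convex _ _ _ rg _ _ _ _ _ h1 h2 dq1 dq2 t0 t1) _.
have := ler_wpM2l t0 (qmin _ _ h1 h2 h3 h4); lra.
Qed.

End Minimizers.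

(** * The scheduling problem *)

Section Scheduling.
Context {R : realType} {M : scheduling R}.
Hypothesis hM : standing_assumptions M.
Implicit Types (s t : state M) (n : nat).

Let d1 := demand (rcv1 M).
Let d2 := demand (rcv2 M).
Let c1 s := unit_cost (rcv1 M) s.1.
Let c2 s := unit_cost (rcv2 M) s.2.
Let P := power M.

Lemma demands_ge0 : 0 <= d1 /\ 0 <= d2.
Proof.
by split; apply/ltW/ra_demand_gt0; case: hM.
Qed.

Lemma unit_costs_gt0 s : 0 < c1 s /\ 0 < c2 s.
Proof. by split; apply: ra_cost_gt0; case: hM. Qed.

Lemma feasibleE s (x y : R * R) :
  feasible x s y <-> budgeted d1 d2 (c1 s) (c2 s) P x.1 x.2 y.1 y.2.
Proof.
have [d10 d20] := demands_ge0; split.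
  by case=> _ [] /=; rewrite !ge_max => /andP[? ?] /andP[? ?] ?; split.
case=> h1 h2 h3 h4 h5; split=> //; split; rewrite /= ?ge_max; try exact/andP.
  exact: le_trans h1.
exact: le_trans h2.
Qed.

Lemma objective_regular (v : R * R -> state M -> R) s :
  (forall t, regular 0 0 (fun x1 x2 => v (x1, x2) t)) ->
  regular d1 d2 (fun y1 y2 => objective v (y1, y2) s).
Proof.
move=> rv; have [r1 r2 _ /andP[a0 _] _] := hM.
apply: regularD; first apply: regularD; first exact: regular_linear.
  apply: (regular_shift _ _ (fun x1 x2 => hold (rcv1 M) x1 + hold (rcv2 M) x2)).
  apply: regular_sep.
  - by move=> *; apply: convex_function_chord => //; case: r1.
  - by move=> *; apply: convex_function_chord => //; case: r2.
  - by apply: monotone_convex_lipschitz; case: r1.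
  - by apply: monotone_convex_lipschitz; case: r2.
apply: regularZ => //.
apply: (regular_shift _ _ (fun x1 x2 => cond_expect (v (x1, x2)) s)).
apply: regular_sum => t1; apply: regular_sum => t2; apply: regularZ => //.
by apply: mulr_ge0; [case: r1 => -[] | case: r2 => -[]].
Qed.

Lemma objective_coercive (v : R * R -> state M -> R) s (y1 y2 : R) :
  (forall x1 x2 t, 0 <= x1 -> 0 <= x2 -> 0 <= v (x1, x2) t) ->
  d1 <= y1 -> d2 <= y2 -> c1 s * y1 + c2 s * y2 <= objective v (y1, y2) s.
Proof.
move=> v0 h1 h2; have [r1 r2 _ /andP[a0 _] _] := hM.
rewrite /objective -addrA lerDl addr_ge0 // ?addr_ge0 //.
- by apply: ra_hold_ge0; rewrite // subr_ge0.
- by apply: ra_hold_ge0; rewrite // subr_ge0.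
apply: mulr_ge0 => //; apply: sumr_ge0 => t1 _; apply: sumr_ge0 => t2 _.
apply: mulr_ge0; first by apply: mulr_ge0; [case: r1 => -[] | case: r2 => -[]].
by apply: v0; rewrite subr_ge0.
Qed.

Lemma V_succ n (x1 x2 : R) s : V n.+1 (x1, x2) s = - c1 s * x1 + - c2 s * x2 +
  @budget_value R d1 d2 (c1 s) (c2 s) P
     (fun y1 y2 => objective (V n) (y1, y2) s) x1 x2.
Proof.
rewrite /= /dot /= opprD !mulNr; congr (_ + inf _).
apply/seteqP; split=> _ [[y1 y2] Hy <-]; exists (y1, y2) => //.
  exact/(feasibleE s (x1, x2)).
exact/feasibleE.
Qed.

(** Nonnegativity is preserved because an action costs at least [c . y >= c . x], which offsets the
    term [- c . x]; it yields the coercivity of [G]. *)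
Lemma V_regular n : forall s,
  regular 0 0 (fun x1 x2 => V n (x1, x2) s) /\
  forall x1 x2, 0 <= x1 -> 0 <= x2 -> 0 <= V n (x1, x2) s.
Proof.
elim: n => [|n IH] s; first by split=> //; exact: regular0.
have [d10 d20] := demands_ge0; have [c10 c20] := unit_costs_gt0 s.
have dP : c1 s * d1 + c2 s * d2 <= P := sa_demand_feasible hM s.
have rg := objective_regular (V n) s (fun t => proj1 (IH t)).
split=> [|x1 x2 x10 x20].
  under eq_fun do under eq_fun do rewrite V_succ.
  apply: regularD; first exact: regular_linear.
  exact: budget_value_regular.
rewrite V_succ.
have [y1 [y2 [[h1 h2 h3 h4 _] ->]]] :=
  budget_value_attained c10 c20 rg d10 d20 dP _ _ x10 x20.
have := objective_coercive (V n) s y1 y2 (fun z1 z2 t => proj2 (IH t) z1 z2) h1 h2.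
have : c1 s * x1 <= c1 s * y1 by rewrite ler_pM2l.
have : c2 s * x2 <= c2 s * y2 by rewrite ler_pM2l.
lra.
Qed.

(** * A fixed slot and channel state *)

Section Stage.
Variables (n : nat) (s : state M).

Let g := fun y1 y2 => G n (y1, y2) s.

Lemma G_regular : regular d1 d2 g.
Proof. by apply: objective_regular => t; case: (V_regular n.-1 t). Qed.

Lemma G_coercive (y1 y2 : R) : d1 <= y1 -> d2 <= y2 -> c1 s * y1 + c2 s * y2 <= g y1 y2.
Proof.
by apply: objective_coercive => x1 x2 t; case: (V_regular n.-1 t) => _; apply.
Qed.

Lemma B_minimizerP (y1 y2 : R) : B n s (y1, y2) <-> minimizer d1 d2 g y1 y2.
Proof.
split=> [[[/= h1 h2] H]|[h1 h2 H]].
  by split=> // z1 z2 k1 k2; apply: (H (z1, z2)).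
by split=> // -[z1 z2] [/= k1 k2]; exact: H.
Qed.

(** The nested infima [b1] and [b2] are the coordinates of the lexicographically least minimizer. *)
Lemma b_minimizer : minimizer d1 d2 g (b1 n s) (b2 n s) /\
  (forall y1 y2, minimizer d1 d2 g y1 y2 -> b1 n s <= y1) /\
  (forall y2, minimizer d1 d2 g (b1 n s) y2 -> b2 n s <= y2).
Proof.
have [d10 d20] := demands_ge0; have [c10 c20] := unit_costs_gt0 s.
have [y1 [y2 [Hy y1min y2min]]] :=
  lex_least_minimizer d10 d20 c10 c20 G_regular G_coercive.
have E1 : b1 n s = y1.
  apply: inf_minimum; first by exists y2; exact/B_minimizerP.
  by move=> z1 [z2 /B_minimizerP]; exact: y1min.
have E2 : b2 n s = y2.
  rewrite /b2 E1; apply: inf_minimum; first exact/B_minimizerP.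
  by move=> z2 /B_minimizerP; exact: y2min.
by rewrite E1 E2.
Qed.

Lemma least_argmin_inf d (k : R -> R) (m : R) : least_argmin d k m ->
  argmin `[d, +oo[%classic k m /\ inf (argmin `[d, +oo[%classic k) = m.
Proof.
case=> dm mk mmin.
have mA : argmin `[d, +oo[%classic k m.
  by split=> [|z] /=; rewrite in_itv /= andbT //; exact: mk.
split=> //; apply: inf_minimum => // z [/=]; rewrite in_itv /= andbT => dz zk.
by apply: mmin => // w dw; apply: zk; rewrite /= in_itv /= andbT.
Qed.

Lemma f1_least (x2 : R) : d2 <= x2 ->
  argmin1 n x2 s (f1 n x2 s) /\ least_argmin d1 (fun y => g y x2) (f1 n x2 s).
Proof.
have [d10 d20] := demands_ge0; have [c10 c20] := unit_costs_gt0 s.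
move=> dx2; have [m Hm] := least_argmin1 d10 d20 c10 c20 G_regular G_coercive _ dx2.
by have [mA E] := least_argmin_inf _ _ _ Hm; rewrite /f1 /argmin1 E.
Qed.

Lemma f2_least (x1 : R) : d1 <= x1 ->
  argmin2 n x1 s (f2 n x1 s) /\ least_argmin d2 (g x1) (f2 n x1 s).
Proof.
have [d10 d20] := demands_ge0; have [c10 c20] := unit_costs_gt0 s.
move=> dx1; have [|m Hm] := least_argmin1 d20 d10 c20 c10
    (regular_swap _ _ _ G_regular) _ _ dx1.
  by move=> y1 y2 h1 h2; rewrite addrC; exact: G_coercive.
by have [mA E] := least_argmin_inf _ _ _ Hm; rewrite /f2 /argmin2 E.
Qed.

(** A minimizer in the row of [b2] does as well as [b], hence is a global minimizer, so it is no
    smaller than [b1]. *)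
Lemma f1_b2 : f1 n (b2 n s) s = b1 n s.
Proof.
have [Hb [b1min _]] := b_minimizer; have [B1 B2 B3] := Hb.
have [_ [F1 F2 F3]] := f1_least _ B2.
apply/eqP; rewrite eq_le; apply/andP; split.
  by apply: F3 => // w dw; exact: B3.
by apply: (b1min _ (b2 n s)); apply: minimizer_le Hb _ _ _ => //; exact: F2.
Qed.

Lemma f2_b1 : f2 n (b1 n s) s = b2 n s.
Proof.
have [Hb [_ b2min]] := b_minimizer; have [B1 B2 B3] := Hb.
have [_ [F1 F2 F3]] := f2_least _ B1.
apply/eqP; rewrite eq_le; apply/andP; split.
  by apply: F3 => // w dw; exact: B3.
by apply: b2min; apply: minimizer_le Hb _ _ _ => //; exact: F2.
Qed.

(** * The seven regions *)

Let rg := G_regular.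
Let rg' := regular_swap _ _ _ G_regular.
Let bmin := proj1 b_minimizer.
Let bmin' := minimizer_swap _ _ _ _ _ bmin.
Let F1P x2 dx2 := proj2 (f1_least x2 dx2).
Let F2P x1 dx1 := proj2 (f2_least x1 dx1).

(** Covering and disjointness together say that the regions are the fibres of this function. *)
Definition region_of (x : R * R) : region_name :=
  if (x.1 <= b1 n s) && (x.2 <= b2 n s) then
    if dot (cvec s) (b n s - x) <= P then II else IV_B
  else if (b2 n s < x.2) && (x.1 < f1 n x.2 s) then
    if f1 n x.2 s - P / (cvec s).1 <= x.1 then III_A else IV_A
  else if (b1 n s < x.1) && (x.2 < f2 n x.1 s) then
    if f2 n x.1 s - P / (cvec s).2 <= x.2 then III_B else IV_C
  else I.

Lemma f2_le_b2 (x1 : R) : b1 n s <= x1 -> f2 n x1 s <= b2 n s.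
Proof.
move=> bx; have [B1 _ _] := bmin; rewrite -f2_b1.
exact: (least_argmin1_nonincreasing rg' F2P).
Qed.

Lemma region_region_of (x : R * R) : vle 0 x -> region n s (region_of x) x.
Proof.
move=> x0; have [B1 B2 B3] := bmin; rewrite /region_of.
case: ifP => [/andP[h1 h2]|/negbT nb].
  by case: ifP => [h|/negbT]; [split | rewrite -ltNge; split].
case: ifP => [/andP[h1 h2]|/negbT nA].
  by case: ifP => [h|/negbT]; [split=> //; apply/andP | rewrite -ltNge; split].
case: ifP => [/andP[h1 h2]|/negbT nC].
  by case: ifP => [h|/negbT]; [split=> //; apply/andP | rewrite -ltNge; split].
rewrite !negb_and -!leNgt -?ltNge in nb nA nC.
have above : b2 n s < x.2 -> [/\ d2 <= x.2, d1 <= x.1 & f1 n x.2 s <= x.1].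
  move=> h; rewrite leNgt h /= in nA.
  have dx : d2 <= x.2 by rewrite (le_trans B2) // ltW.
  by split=> //; apply: le_trans nA; case: (F1P _ dx).
have right : b1 n s < x.1 -> [/\ d1 <= x.1, d2 <= x.2 & f2 n x.1 s <= x.2].
  move=> h; rewrite leNgt h /= in nC.
  have dx : d1 <= x.1 by rewrite (le_trans B1) // ltW.
  by split=> //; apply: le_trans nC; case: (F2P _ dx).
(* If only one coordinate exceeds that of [b], the failed tests give one of the two inequalities of
   region I; [column_argmin_le] gives the other. *)
have [h1|h1] := ltP (b1 n s) x.1; have [h2|h2] := ltP (b2 n s) x.2.
- have [e1 e2 e3] := above h2; have [e4 e5 e6] := right h1.
  by split=> // E; rewrite E /= ltxx in h1.
- have [e4 e5 e6] := right h1.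
  split=> //; last by move=> E; rewrite E /= ltxx in h1.
  by split=> //; exact: (column_argmin_le rg' bmin' F2P F1P).
- have [e1 e2 e3] := above h2.
  split=> //; last by move=> E; rewrite E /= ltxx in h2.
  by split=> //; exact: (column_argmin_le rg bmin F1P F2P).
- by move: nb; rewrite !ltNge h1 h2.
Qed.

Lemma region_unique (x : R * R) k : region n s k x -> k = region_of x.
Proof.
rewrite /region_of; case: k => /=.
- case=> x0 [dx1 dx2] [/= h1 h2] xb.
  rewrite [x.1 < _]ltNge h1 andbF [x.2 < _]ltNge h2 andbF.
  (* A point of region I below [b] is [b] itself: by monotonicity [b1 = f1 b2 <= f1 x.2 <= x.1], and
     likewise for [b2]. *)
  case: ifP => // /andP[k1 k2]; exfalso; apply: xb.
  have e1 : b1 n s <= f1 n x.2 s.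
    by rewrite -f1_b2; exact: (least_argmin1_nonincreasing rg F1P).
  have e2 : b2 n s <= f2 n x.1 s.
    by rewrite -f2_b1; exact: (least_argmin1_nonincreasing rg' F2P).
  rewrite /b (surjective_pairing x); congr pair; apply/eqP; rewrite eq_le.
    by rewrite k1 (le_trans e1).
  by rewrite k2 (le_trans e2).
- by case=> _ [/= -> ->] /= ->.
- by case=> _ h /andP[k1 k2]; rewrite [x.2 <= _]leNgt h andbF k2 k1.
- case=> _ h /andP[k1 k2].
  (* As [f2] is nonincreasing, points of III-B lie strictly below the row of [b2], so the test for
     the A regions fails. *)
  have hb : x.2 < b2 n s by apply: lt_le_trans k2 _; apply: f2_le_b2; exact: ltW.
  by rewrite [x.1 <= _]leNgt h /= [b2 n s < _]ltNge (ltW hb) /= k2 k1.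
- case=> _ h k; rewrite [x.2 <= _]leNgt h andbF [_ <= x.1]leNgt k /=.
  rewrite ifT // (lt_le_trans k) // gerBl.
  by rewrite divr_ge0 // ltW //; [case: hM | case: (unit_costs_gt0 s)].
- by case=> _ [/= -> ->] /=; rewrite ltNge => /negbTE ->.
- case=> _ h k; have k2 : x.2 < f2 n x.1 s.
    rewrite (lt_le_trans k) // gerBl.
    by rewrite divr_ge0 // ltW //; [case: hM | case: (unit_costs_gt0 s)].
  have hb : x.2 < b2 n s by apply: lt_le_trans k2 _; apply: f2_le_b2; exact: ltW.
  by rewrite [x.1 <= _]leNgt h /= [b2 n s < _]ltNge (ltW hb) /= k2 [_ <= x.2]leNgt k.
Qed.

(** * Optimal actions in each region *)

Lemma optimal_actionE (x : R * R) (y1 y2 : R) :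
  budgeted d1 d2 (c1 s) (c2 s) P x.1 x.2 y1 y2 ->
  (forall z1 z2, budgeted d1 d2 (c1 s) (c2 s) P x.1 x.2 z1 z2 -> g y1 y2 <= g z1 z2) ->
  optimal_action n x s (y1, y2).
Proof.
by move=> Hy ymin; split=> [|[z1 z2] /feasibleE]; [exact/feasibleE | exact: ymin].
Qed.

Lemma ystar_optimal (x : R * R) : vle 0 x -> ~ RIV n s x ->
  optimal_action n x s (ystar n x s).
Proof.
move=> x0 nIV; have [c10 c20] := unit_costs_gt0 s.
have P0 : 0 <= P := ltW (sa_power_gt0 hM).
have [B1 B2 B3] := bmin.
have := region_region_of x x0; rewrite /ystar.
case: asboolP => [[_ [dx1 dx2] [h1 h2] _] _|nI].
  rewrite [X in optimal_action _ _ _ X]surjective_pairing.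
  apply: optimal_actionE => [|z1 z2 [k1 k2 k3 k4 k5]].
    by split=> //; rewrite !subrr !mulr0 addr0.
  have [_ F2min _] := F2P _ dx1.
  apply: (stay_optimal rg F1P) => //.
  exact: (row_nondecreasing rg' F2P).
case: asboolP => [[_ [h1 h2] h3] _|nII].
  apply: optimal_actionE => [|z1 z2 [k1 k2 k3 k4 k5]]; first by split.
  exact: B3.
case: asboolP => [[_ h1 /andP[h2 h3]] _|nIIIA].
  have dx2 : d2 <= x.2 by rewrite (le_trans B2) // ltW.
  apply: optimal_actionE => [|z1 z2 [k1 k2 k3 k4 k5]].
    have [F1 _ _] := F1P _ dx2; split=> //; first exact: ltW.
    by rewrite subrr mulr0 addr0 mulrC -ler_pdivlMr // lerBlDr -lerBlDl.
  exact: (row_argmin_optimal rg bmin F1P).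
(* Only III-B is left, which is the default branch of [ystar]. *)
case: (region_of x) => //= [[_ h1 /andP[h2 h3]]|h|h|h]; last 3 first.
- by case: nIV; left; left.
- by case: nIV; left; right.
- by case: nIV; right.
have dx1 : d1 <= x.1 by rewrite (le_trans B1) // ltW.
apply: optimal_actionE => [|z1 z2 [k1 k2 k3 k4 k5]].
  have [F2 _ _] := F2P _ dx1; split=> //; first exact: ltW.
  by rewrite subrr mulr0 add0r mulrC -ler_pdivlMr // lerBlDr -lerBlDl.
exact: (row_argmin_optimal rg' bmin' F2P).
Qed.

Lemma RIV_full_power (x : R * R) : RIV n s x ->
  exists y, optimal_action n x s y /\ dot (cvec s) (y - x) = P.
Proof.
have [d10 d20] := demands_ge0; have [c10 c20] := unit_costs_gt0 s.
have dP : c1 s * d1 + c2 s * d2 <= P := sa_demand_feasible hM s.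
have [B1 B2 B3] := bmin.
have P0 : 0 <= P := ltW (sa_power_gt0 hM).
(* [q] is the action that unlimited power would allow: [(f1 x.2, x.2)] in IV-A, [b] in IV-B,
   [(x.1, f2 x.1)] in IV-C. *)
suff H q1 q2 : vle 0 x -> d1 <= q1 -> d2 <= q2 -> x.1 <= q1 -> x.2 <= q2 ->
    P < c1 s * (q1 - x.1) + c2 s * (q2 - x.2) ->
    (forall y1 y2, d1 <= y1 -> d2 <= y2 -> x.1 <= y1 -> x.2 <= y2 ->
       g q1 q2 <= g y1 y2) ->
    exists y, optimal_action n x s y /\ dot (cvec s) (y - x) = P.
  move=> [[[x0 h1 h2]|[x0 [h1 h2] h3]]|[x0 h1 h2]].
  - have dx2 : d2 <= x.2 by rewrite (le_trans B2) // ltW.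
    have [F1 _ _] := F1P _ dx2.
    have k : P < c1 s * (f1 n x.2 s - x.1).
      by rewrite mulrC -ltr_pdivrMr // ltrBrDr -ltrBrDl.
    apply: (H (f1 n x.2 s) x.2) => //.
    + by rewrite -subr_ge0 -(pmulr_rge0 _ c10) ltW // (le_lt_trans P0).
    + by rewrite subrr mulr0 addr0.
    + by move=> y1 y2 *; exact: (row_argmin_optimal rg bmin F1P).
  - by apply: (H (b1 n s) (b2 n s)) => // *; exact: B3.
  - have dx1 : d1 <= x.1 by rewrite (le_trans B1) // ltW.
    have [F2 _ _] := F2P _ dx1.
    have k : P < c2 s * (f2 n x.1 s - x.2).
      by rewrite mulrC -ltr_pdivrMr // ltrBrDr -ltrBrDl.
    apply: (H x.1 (f2 n x.1 s)) => //.
    + by rewrite -subr_ge0 -(pmulr_rge0 _ c20) ltW // (le_lt_trans P0).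
    + by rewrite subrr mulr0 add0r.
    + by move=> y1 y2 *; exact: (row_argmin_optimal rg' bmin' F2P).
move=> [x10 x20] dq1 dq2 xq1 xq2 hq qmin.
have [y1 [y2 [Hy ymin E]]] := full_power_optimal _ _ _ _ _ _ _ _ _ _
  c10 c20 rg d10 d20 dP x10 x20 dq1 dq2 xq1 xq2 hq qmin.
by exists (y1, y2); split=> //; exact: optimal_actionE.
Qed.

End Stage.

End Scheduling.

Theorem theorem8 (R : realType) (M : scheduling R)
    (hM : standing_assumptions M) (N n : nat) (hn : (1 <= n <= N)%N)
    (s : state M) :
  (* the global minimizers, and b *)
  B n s !=set0 /\
  B n s (b n s) /\
  (* the infima defining f1 and f2 are over nonempty sets *)
  (forall x2 : R, demand (rcv2 M) <= x2 -> argmin1 n x2 s !=set0) /\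
  (forall x1 : R, demand (rcv1 M) <= x1 -> argmin2 n x1 s !=set0) /\
  f1 n (b2 n s) s = b1 n s /\
  f2 n (b1 n s) s = b2 n s /\
  (* the seven regions partition the nonnegative orthant *)
  cover setT (region n s) = [set x : R * R | vle 0 x] /\
  trivIset setT (region n s) /\
  (* optimal actions *)
  (forall x : R * R, vle 0 x -> ~ RIV n s x ->
     optimal_action n x s (ystar n x s)) /\
  (forall x : R * R, RIV n s x ->
     exists y : R * R, optimal_action n x s y /\
       dot (cvec s) (y - x) = power M).
Proof.
have Bb : B n s (b n s) by apply/B_minimizerP; have [] := b_minimizer hM n s.
split; first by exists (b n s).
split=> //; split; first by move=> x2 /(f1_least hM n s)[]; exists (f1 n x2 s).
split; first by move=> x1 /(f2_least hM n s)[]; exists (f2 n x1 s).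
split; first exact: f1_b2.
split; first exact: f2_b1.
split.
  apply/seteqP; split=> [x [k _]|x x0]; first by case: k => -[].
  by exists (region_of n s x) => //; exact: region_region_of.
split.
  by move=> i j _ _ [x [/(region_unique hM) -> /(region_unique hM) ->]].
split; [exact: ystar_optimal | exact: RIV_full_power].
Qed.
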